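(* Let $V_6$ be the irreducible faithful six-dimensional complex representation of the binary icosahedral group $\tilde{\mathfrak A}_5$. Then the variety $\mathbb P(V_6)/\mathfrak A_5$ is rational.
   Context: The ground field is $\mathbb C$. The binary icosahedral group $\tilde{\mathfrak A}_5\simeq\mathrm{SL}_2(\mathbb F_5)$ is the unique non-trivial central extension of $\mathfrak A_5$ by the cyclic group of order $2$. One has $V_6=\mathrm S^5(V_2)$, where $V_2$ is a faithful two-dimensional representation of $\tilde{\mathfrak A}_5$. The center of $\tilde{\mathfrak A}_5$ acts on $V_6$ by scalars, so $\mathfrak A_5=\tilde{\mathfrak A}_5/\{\pm1\}$ acts on $\mathbb P(V_6)\simeq\mathbb P^5$. *)

(* Defs.v *)
From HB Require Import structures.
From mathcomp Require Import all_boot all_order all_algebra all_fingroup.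
From mathcomp Require Import all_solvable all_character.
From mathcomp Require Import mpoly complex generic_quotient.

Set Implicit Arguments.
Unset Strict Implicit.
Unset Printing Implicit Defensive.

Import GRing.Theory.
Local Open Scope ring_scope.

Local Notation "x %:F" := (@FracField.tofrac _ x).

(* A non-trivial central extension of 'Alt_5 by a group of order 2; up to      *)
(* isomorphism there is exactly one such group, namely SL_2(F_5). Triviality   *)
(* of a central extension is the same as the existence of a complement to Z.   *)
Definition binary_icosahedral (gT : finGroupType) (G : {group gT}) : Prop :=
  exists Z : {group gT},
    [/\ Z \subset 'Z(G)%g, #|Z| = 2%N,
        (G / Z)%g \isog 'Alt_('I_5) & ~~ splits_over G Z].

Section FunctionFields.

Variable k : fieldType.

(* The polynomial function v |-> p (v *m A) on row vectors v.                  *)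
Definition mpoly_act (n : nat) (A : 'M[k]_n) (p : {mpoly k[n]}) : {mpoly k[n]} :=
  p \mPo [tuple \sum_(i < n) A i j *: 'X_i | j < n].

(* The extension of mpoly_act A to fractions; it is independent of the chosen  *)
(* numerator and denominator when A is invertible, see frac_actE.              *)
Definition frac_act (n : nat) (A : 'M[k]_n) (f : {fraction {mpoly k[n]}}) :
    {fraction {mpoly k[n]}} :=
  (mpoly_act A \n_(repr f))%:F / (mpoly_act A \d_(repr f))%:F.

(* The function field k(P(V)), for dim V = n.                                  *)
Definition proj_function_field (n : nat) (f : {fraction {mpoly k[n]}}) : Prop :=
  exists (d : nat) (p q : {mpoly k[n]}),
    [/\ p \is d.-homog, q \is d.-homog, q != 0 & f = p%:F / q%:F].

(* The function field k(P(V)/G) = k(P(V))^G of the quotient variety, for a     *)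
(* finite group G acting linearly on V. Elements of G acting on V by scalars   *)
(* act trivially on k(P(V)), so only the image of G in PGL(V) matters. This    *)
(* is also the function field of Proj k[V]^G, see                              *)
(* proj_quotient_function_fieldE.                                              *)
Definition proj_quotient_function_field (gT : finGroupType) (G : {group gT})
    (n : nat) (rG : mx_representation k G n) (f : {fraction {mpoly k[n]}}) :
    Prop :=
  proj_function_field f /\ (forall g, g \in G -> frac_act (rG g) f = f).

(* The subfield K is k-isomorphic to k(t_1, ..., t_m).                         *)
Definition purely_transcendental (m n : nat)
    (K : {fraction {mpoly k[n]}} -> Prop) : Prop :=
  exists phi : {rmorphism {fraction {mpoly k[m]}} -> {fraction {mpoly k[n]}}},
    (forall c : k, phi (c%:MP)%:F = (c%:MP)%:F)
    /\ (forall f, K f <-> exists x, phi x = f).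

(* Rationality of the n-dimensional variety P(V)/G, where dim V = n.+1: its    *)
(* function field is k-isomorphic to that of the affine space of dimension n.  *)
Definition proj_quotient_rational (gT : finGroupType) (G : {group gT})
    (n : nat) (rG : mx_representation k G n.+1) : Prop :=
  purely_transcendental n (proj_quotient_function_field rG).

Section Action.

Variable n : nat.
Implicit Types (A B : 'M[k]_n) (p q : {mpoly k[n]}).

Lemma mpoly_actM A p q : mpoly_act A (p * q) = mpoly_act A p * mpoly_act A q.
Proof. exact: rmorphM. Qed.

Lemma mpoly_act_prod A (I : Type) (r : seq I) (P : pred I) F :
  mpoly_act A (\prod_(i <- r | P i) F i) =
  \prod_(i <- r | P i) mpoly_act A (F i).
Proof. exact: rmorph_prod. Qed.

Lemma mpoly_actX A (i : 'I_n) :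
  mpoly_act A 'X_i = \sum_(j < n) A j i *: 'X_j.
Proof. by rewrite /mpoly_act comp_mpolyXU -tnth_nth tnth_mktuple. Qed.

Lemma mpoly_act_comp A B p :
  mpoly_act A (mpoly_act B p) = mpoly_act (A *m B) p.
Proof.
rewrite {2}/mpoly_act comp_mpolyE /mpoly_act [RHS]comp_mpolyE raddf_sum /=.
apply: eq_bigr => m _; rewrite linearZ /= rmorph_prod /=; congr (_ *: _).
apply: eq_bigr => j _; rewrite rmorphXn /= !tnth_mktuple; congr (_ ^+ _).
rewrite raddf_sum /=.
under eq_bigr => i _ do
  rewrite linearZ /= -/(mpoly_act A 'X_i) mpoly_actX scaler_sumr.
rewrite exchange_big /=; apply: eq_bigr => i _.
rewrite mxE scaler_suml; apply: eq_bigr => l _.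
by rewrite scalerA mulrC.
Qed.

Lemma mpoly_act1 p : mpoly_act 1%:M p = p.
Proof.
rewrite -[RHS]comp_mpoly_id /mpoly_act; congr (_ \mPo _).
apply: eq_from_tnth => i; rewrite !tnth_mktuple (bigD1 i) //= mxE eqxx scale1r.
by rewrite big1 ?addr0 // => j /negPf ji; rewrite mxE ji scale0r.
Qed.

Lemma mpoly_act_eq0 A p : A \in unitmx -> (mpoly_act A p == 0) = (p == 0).
Proof.
move=> uA; apply/eqP/eqP => [p0|->]; last exact: raddf0.
rewrite -(mpoly_act1 p) -(mulVmx uA) -mpoly_act_comp p0; exact: raddf0.
Qed.

Lemma mpoly_act_homog A p d : p \is d.-homog -> mpoly_act A p \is d.-homog.
Proof.
move=> /dhomogP hp; rewrite /mpoly_act comp_mpolyE.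
rewrite big_seq; apply: rpred_sum => m /hp dm; apply: rpredZ.
rewrite -{}dm /= mdegE; apply: (big_ind2 (fun x e => x \is e.-homog)).
- exact: dhomog1.
- by move=> x1 d1 x2 d2; apply: dhomogM.
move=> i _; rewrite -[X in X.-homog]mul1n; apply: dhomogMn.
rewrite tnth_mktuple; apply: rpred_sum => j _; apply: rpredZ.
by rewrite dhomogX /= mdeg1.
Qed.

Lemma frac_actE A p q : A \in unitmx -> q != 0 ->
  frac_act A (p%:F / q%:F) = (mpoly_act A p)%:F / (mpoly_act A q)%:F.
Proof.
move=> uA q0; rewrite /frac_act; set f := p%:F / q%:F.
have d0 : \d_(repr f) != 0 by exact: denom_ratioP.
have fE : f = (\n_(repr f))%:F / (\d_(repr f))%:F.
  rewrite -[LHS]reprK -{1}[repr f]Ratio_numden; unlock FracField.tofrac.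
  rewrite -[_^-1]FracField.pi_inv -[RHS]FracField.pi_mul.
  rewrite /FracField.invf /FracField.mulf /=.
  by rewrite !numden_Ratio ?oner_eq0 ?mulr1 ?mul1r.
move: fE; rewrite {1}/f => /eqP.
rewrite eqr_div ?tofrac_eq0 // -!tofracM tofrac_eq => /eqP E.
apply/eqP; rewrite eqr_div ?tofrac_eq0 ?mpoly_act_eq0 //.
by rewrite -!tofracM tofrac_eq -!mpoly_actM E.
Qed.

End Action.

Lemma proj_quotient_function_fieldE (gT : finGroupType) (G : {group gT})
    (n : nat) (rG : mx_representation k G n) (f : {fraction {mpoly k[n]}}) :
  proj_quotient_function_field rG f <->
  exists (d : nat) (p q : {mpoly k[n]}),
    [/\ p \is d.-homog /\ (forall g, g \in G -> mpoly_act (rG g) p = p),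
        q \is d.-homog /\ (forall g, g \in G -> mpoly_act (rG g) q = q),
        q != 0 & f = p%:F / q%:F].
Proof.
split=> [[[d [p [q [hp hq q0 fE]]]] fG] | [d [p [q [[hp pG] [hq qG] q0 ->]]]]];
  last first.
  split; first by exists d, p, q.
  by move=> g gG; rewrite frac_actE ?repr_mx_unit // pG ?qG.
pose r := \prod_(g in G | g != 1%g) mpoly_act (rG g) q.
have qrE : q * r = \prod_(g in G) mpoly_act (rG g) q.
  by rewrite (bigD1 1%g) //= repr_mx1 mpoly_act1.
have r0 : r != 0.
  by apply/prodf_neq0 => g /andP[gG _]; rewrite mpoly_act_eq0 ?repr_mx_unit.
have qr0 : q * r != 0 by rewrite mulf_neq0.
have hr : exists e, r \is e.-homog.
  rewrite /r; elim/big_rec: _ => [|g x _ [e hx]].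
    by exists 0%N; apply: dhomog1.
  by exists (d + e)%N; apply: dhomogM; first exact: mpoly_act_homog.
case: hr => e hr.
have fE' : f = (p * r)%:F / (q * r)%:F.
  by rewrite fE !tofracM -mulf_div divff ?mulr1 ?tofrac_eq0.
have qrG g : g \in G -> mpoly_act (rG g) (q * r) = q * r.
  move=> gG; rewrite qrE mpoly_act_prod [RHS](reindex_inj (mulgI g)) /=.
  apply: eq_big => h; first by rewrite groupMl.
  by move=> hG; rewrite mpoly_act_comp -repr_mxM.
exists (d + e)%N, (p * r), (q * r); split=> //.
  split; first exact: dhomogM.
  move=> g gG; have := fG g gG.
  rewrite {1}fE' frac_actE ?repr_mx_unit // qrG // fE' => /divIf.
  by rewrite tofrac_eq0 => /(_ qr0) /eqP; rewrite tofrac_eq => /eqP.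
by split; [exact: dhomogM | exact: qrG].
Qed.

End FunctionFields.

(* Main.v *)
Require Import Defs.
From HB Require Import structures.
From mathcomp Require Import all_boot all_order all_algebra all_fingroup.
From mathcomp Require Import all_solvable all_character.
From mathcomp Require Import mpoly complex generic_quotient ring boolp.
From mathcomp Require Import reals.

(** The representation V_6 is the space of binary quintics. Indeed G is perfect,
    because its extension of a simple group does not split, and so the irreducible
    representations in which the central involution z acts as -1 have even degree. The
    regular character vanishes at z, so the squares of their degrees add up to
    120 / 2 = 60 (sum_odd_degree). One of them is V_6 itself by Schur's lemma. The remaining
    24 is not a multiple of 16, so not all the others have degree 4, and there is one
    of degree 2 (odd_irreducible_degree2). It maps G faithfully into SL_2, and its
    fifth symmetric power is irreducible (sym5_stable_full, by matrices for a
    five-cycle and two commuting involutions). As 60 < 36 + 36, the fifth symmetric power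
    is V_6.

    The rest holds for every finite group G with a representation rho of determinant 1
    on the plane (sym5_rational). A quintic F defines a linear map from the pairs
    u = (b, C) of a linear and a cubic form to the quartics, u |-> (F, b)_1 + (F, C)_2, by
    transvectants. It goes from dimension 6 to dimension 5, so its maximal minors give
    a kernel vector u(F), covariant under SL_2 (trans_mx_equivariant). Seen the other
    way round, F is in the kernel of a map from dimension 6 to 5 that depends on u;
    therefore F |-> u(F) is, equivariantly, birational from P(V_6) to the projective
    space of pairs. Two explicit quintics show that nothing degenerates.

    The zero of the linear form b makes the space of pairs a vector bundle over the
    projective line, on which G acts. Normalize b to z X + Y. A second linear form
    that moves along with it is obtained by averaging over G (exists_frame), and the
    coefficients of C in this frame are four invariants w. A fifth one, t, is the
    product of y - e over the orbit of z, for a suitable constant e. The function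
    field is k(t, w)(z).

    The element t is a fraction in z of degree at most the size of the orbit of z. Let
    f = a(z) / b(z) be a G-invariant fraction over k(t, w), with a and b reduced
    modulo the relation between t and z. The polynomial a - f b vanishes on the orbit,
    which has more elements than its degree; hence it is zero, and f lies in k(t, w)
    (fixed_field_generated). Finally t and w are independent: a derivation over k that
    kills them kills z, which is algebraic over k(t), and together with one
    homogeneous coordinate it kills everything, so the Jacobian determinant is not
    zero (jacobian_criterion). *)

Set Implicit Arguments.
Unset Strict Implicit.
Unset Printing Implicit Defensive.

Import Order.TTheory GRing.Theory Num.Theory.
Local Open Scope ring_scope.

Local Notation "x %:F" := (@FracField.tofrac _ x).
(** * Fraction fields *)

Section FracLift.

Variable R : idomainType.

Lemma fracE (f : {fraction R}) : f = (\n_(repr f))%:F / (\d_(repr f))%:F.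
Proof.
rewrite -[LHS]reprK -{1}[repr f]Ratio_numden; unlock FracField.tofrac.
rewrite -[_^-1]FracField.pi_inv -[RHS]FracField.pi_mul.
rewrite /FracField.invf /FracField.mulf /=.
by rewrite !numden_Ratio ?oner_eq0 ?mulr1 ?mul1r ?denom_ratioP.
Qed.

Lemma frac_ind (P : {fraction R} -> Prop) :
  (forall p q, q != 0 -> P (p%:F / q%:F)) -> forall f, P f.
Proof. by move=> H f; rewrite [f]fracE; apply: H; exact: denom_ratioP. Qed.

Lemma frac_addE (p q p' q' : R) : q != 0 -> q' != 0 ->
  p%:F / q%:F + p'%:F / q'%:F = (p * q' + p' * q)%:F / (q * q')%:F.
Proof.
by move=> q0 q0'; rewrite addf_div ?tofrac_eq0 // tofracD !tofracM.
Qed.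

Lemma frac_mulE (p q p' q' : R) :
  p%:F / q%:F * (p'%:F / q'%:F) = (p * p')%:F / (q * q')%:F.
Proof. by rewrite !tofracM invfM mulrACA. Qed.

Variables (F : fieldType) (f : {rmorphism R -> F}).
Hypothesis f_inj : injective f.

(** Indexed by the proof of injectivity, so that the structure of a ring morphism
    can be attached to it. *)
Definition frac_lift (_ : injective f) (x : {fraction R}) : F :=
  f \n_(repr x) / f \d_(repr x).
Local Notation g := (frac_lift f_inj).

Let f_eq0 x : (f x == 0) = (x == 0).
Proof. by rewrite -(inj_eq f_inj) rmorph0. Qed.

Lemma frac_liftE p q : q != 0 -> g (p%:F / q%:F) = f p / f q.
Proof.
move=> q0; have d0 := denom_ratioP (repr (p%:F / q%:F)).
have /eqP := fracE (p%:F / q%:F).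
rewrite eqr_div ?tofrac_eq0 // -!tofracM tofrac_eq => /eqP E.
by apply/eqP; rewrite eqr_div ?f_eq0 // -!rmorphM E.
Qed.

Lemma frac_liftF p : g p%:F = f p.
Proof.
by rewrite -[p%:F]divr1 -[1]tofrac1 frac_liftE ?oner_eq0 // rmorph1 divr1.
Qed.

Fact frac_lift_is_zmod_morphism : zmod_morphism g.
Proof.
elim/frac_ind=> p q q0; elim/frac_ind=> p' q' q0'.
rewrite -[- _]mulNr -tofracN frac_addE // !frac_liftE ?mulf_neq0 //.
rewrite rmorphD !rmorphM rmorphN -addf_div ?f_eq0 //.
by rewrite mulNr.
Qed.

Fact frac_lift_is_monoid_morphism : monoid_morphism g.
Proof.
split; first by rewrite -tofrac1 frac_liftF rmorph1.
elim/frac_ind=> p q q0; elim/frac_ind=> p' q' q0'.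
by rewrite frac_mulE !frac_liftE ?mulf_neq0 // !rmorphM invfM mulrACA.
Qed.

HB.instance Definition _ :=
  GRing.isZmodMorphism.Build {fraction R} F g frac_lift_is_zmod_morphism.
HB.instance Definition _ :=
  GRing.isMonoidMorphism.Build {fraction R} F g frac_lift_is_monoid_morphism.

Lemma frac_extend :
  exists h : {rmorphism {fraction R} -> F}, forall p, h p%:F = f p.
Proof. by exists (frac_lift f_inj); exact: frac_liftF. Qed.

End FracLift.

Lemma mpoly_ring_ind (n : nat) (R : nzRingType) (P : {mpoly R[n]} -> Prop) :
  (forall c, P c%:MP) -> (forall i, P 'X_i) ->
  (forall p q, P p -> P q -> P (p + q)) ->
  (forall p q, P p -> P q -> P (p * q)) -> forall p, P p.
Proof.
move=> HC HX HD HM; elim/mpolyind=> [|c m p _ _ IH]; first by rewrite -[0]mpolyC0.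
apply: (HD) => //; rewrite -mul_mpolyC; apply: (HM) => //.
rewrite mpolyXE_id; apply: big_ind => // [|i _]; first by rewrite -[1]mpolyC1.
by elim: (m i) => [|e IHe]; [rewrite expr0 -[1]mpolyC1 | rewrite exprS; apply: (HM)].
Qed.

Section FracAction.

Variables (k : fieldType) (n : nat).
Local Notation L := {fraction {mpoly k[n]}}.
Implicit Types (A B : 'M[k]_n) (f g : L).

Definition cst (c : k) : L := (c%:MP)%:F.
HB.instance Definition _ := GRing.RMorphism.copy cst
  ((@FracField.tofrac {mpoly k[n]}) \o (@mpolyC n k)).

Lemma frac_act_lift A : A \in unitmx ->
  exists h : {rmorphism L -> L}, forall f, frac_act A f = h f.
Proof.
move=> uA.
pose f : {rmorphism {mpoly k[n]} -> L} :=
  (@FracField.tofrac {mpoly k[n]}) \o (comp_mpoly [tuple \sum_(i < n) A i j *: 'X_i | j < n]).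
have fE p : f p = (mpoly_act A p)%:F by [].
have f_inj : injective f.
  move=> p q /eqP; rewrite !fE tofrac_eq -subr_eq0.
  have -> : mpoly_act A p - mpoly_act A q = mpoly_act A (p - q).
    by rewrite /mpoly_act rmorphB.
  by rewrite mpoly_act_eq0 // subr_eq0 => /eqP.
have [h hE] := frac_extend f_inj; exists h.
elim/frac_ind=> p q q0.
by rewrite frac_actE // fmorph_div !hE !fE.
Qed.

Lemma frac_actF A p : A \in unitmx -> frac_act A p%:F = (mpoly_act A p)%:F.
Proof.
move=> uA; rewrite -[p%:F]divr1 -[1]tofrac1 frac_actE ?oner_eq0 //.
by rewrite /mpoly_act rmorph1 tofrac1 divr1.
Qed.

Lemma frac_act_cst A c : A \in unitmx -> frac_act A (cst c) = cst c.
Proof. by move=> uA; rewrite frac_actF // /mpoly_act comp_mpolyC. Qed.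

End FracAction.

(** * Derivations and algebraic independence *)

Section QuotientRule.

(* The field identities behind the quotient rule, for values dp, dq, dp', dq'
   of a derivation at the numerators and denominators of f and g. *)
Variables (F : fieldType) (q q' dp dq dp' dq' f g : F).
Hypotheses (q0 : q != 0) (q0' : q' != 0).

Fact quotient_ruleD :
  (dp * q' + f * q * dq' + (dp' * q + g * q' * dq)
    - (f + g) * (dq * q' + q * dq')) / (q * q') =
  (dp - f * dq) / q + (dp' - g * dq') / q'.
Proof. by field; rewrite q0 q0'. Qed.

Fact quotient_ruleM :
  (dp * (g * q') + f * q * dp' - f * g * (dq * q' + q * dq')) / (q * q') =
  (dp - f * dq) / q * g + f * ((dp' - g * dq') / q').
Proof. by field; rewrite q0 q0'. Qed.

Fact quotient_rule_eq :
  dp' * q + f * q' * dq = dp * q' + f * q * dq' ->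
  (dp' - f * dq') / q' = (dp - f * dq) / q.
Proof.
move=> E; apply/eqP; rewrite eqr_div // -subr_eq0.
have -> : (dp' - f * dq') * q - (dp - f * dq) * q' =
  (dp' * q + f * q' * dq) - (dp * q' + f * q * dq') by ring.
by rewrite E subrr.
Qed.

End QuotientRule.

Record derivation (L : fieldType) := Derivation {
  der_fun :> L -> L;
  derD : {morph der_fun : f g / f + g};
  derM : forall f g, der_fun (f * g) = der_fun f * g + f * der_fun g
}.

Section Constants.

Variables (L : fieldType) (d : derivation L).
Implicit Types f g : L.

Definition der_const : {pred L} := fun f => d f == 0.

Let der0 : d 0 = 0.
Proof. by apply: (addIr (d 0)); rewrite -derD !add0r. Qed.

Let der1 : d 1 = 0.
Proof. by apply: (addIr (d 1)); rewrite add0r -{3}[1]mulr1 derM mulr1 mul1r. Qed.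

Let derN f : d (- f) = - d f.
Proof. by apply/eqP; rewrite eq_sym eqr_oppLR -addr_eq0 -derD subrr der0. Qed.

Fact der_const_divring : divring_closed der_const.
Proof.
split=> [|f g|f g]; rewrite /in_mem /=; first by rewrite /der_const der1.
  by rewrite /der_const derD derN => /eqP-> /eqP->; rewrite subrr.
rewrite /der_const => /eqP f0 /eqP g0; rewrite derM f0 mul0r add0r.
have [->|gn0] := eqVneq g 0; first by rewrite invr0 der0 mulr0.
move: der1; rewrite -(mulfV gn0) derM g0 mul0r add0r => /eqP.
by rewrite mulf_eq0 (negPf gn0) /= => /eqP->; rewrite mulr0.
Qed.

HB.instance Definition _ := GRing.isDivringClosed.Build L der_const der_const_divring.

(** Differentiating a relation p(f) = 0 gives p'(f) df = 0; either df = 0 or the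
    relation p' of smaller degree holds, and p' does not vanish identically
    since the characteristic is zero. *)
Lemma der_const_algebraic (p : {poly L}) f : [pchar L] =i pred0 ->
  p \is a polyOver der_const -> p != 0 -> root p f -> f \in der_const.
Proof.
move=> char0; have [m] := ubnP (size p); elim: m p => [|m IH] p sp pE p0 pf.
  by move: sp; rewrite ltn0.
have [sp1|sp1] := leqP (size p) 1.
  by move: p0 pf; rewrite (size1_polyC sp1) polyC_eq0 rootC => /negPf->.
have dE (q : {poly L}) : q \is a polyOver der_const ->
    d q.[f] = q^`().[f] * d f.
  elim/poly_ind: q => [|q a IHq] qE; first by rewrite deriv0 !horner0 mul0r der0.
  have aE : a \in der_const.
    by have /polyOverP/(_ 0%N) := qE; rewrite coefD coefMX coefC eqxx add0r.
  have qE' : q \is a polyOver der_const.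
    apply/polyOverP=> i; have /polyOverP/(_ i.+1) := qE.
    by rewrite coefD coefMX coefC addr0.
  rewrite derivMXaddC !hornerE derD derM (IHq qE').
  by move: aE => /eqP->; ring.
have /rootP pf0 := pf.
have := dE _ pE; rewrite pf0 der0 => /esym/eqP.
rewrite mulf_eq0 => /orP[pf'|]; last by [].
have pn0 : p^`() != 0.
  apply: contraTneq sp1 => /polyP/(_ (size p).-2) /eqP.
  rewrite coef_deriv coef0 -leqNgt; case: (size p) (lead_coefE p) => // -[|l] //=.
  rewrite -mulr_natr mulf_eq0 => <-; rewrite lead_coef_eq0 (negPf p0) /=.
  by move/pcharf0P: char0 => ->.
apply: (IH p^`()) => //; first exact: leq_trans (lt_size_deriv p0) _.
by apply/polyOverP=> i; rewrite coef_deriv rpredMn //; exact/polyOverP.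
Qed.

End Constants.

Section Derivation.

Variables (k : numFieldType) (n : nat).
Local Notation L := {fraction {mpoly k[n]}}.
Implicit Types (c : 'I_n -> L) (f g : L) (p q : {mpoly k[n]}).

Definition mpoly_der c p : L := \sum_j c j * (p^`M(j))%:F.

Lemma mpoly_derD c p q : mpoly_der c (p + q) = mpoly_der c p + mpoly_der c q.
Proof.
rewrite /mpoly_der -big_split; apply: eq_bigr => j _ /=.
by rewrite mderivD tofracD mulrDr.
Qed.

Lemma mpoly_derM c p q :
  mpoly_der c (p * q) = mpoly_der c p * q%:F + p%:F * mpoly_der c q.
Proof.
rewrite /mpoly_der mulr_suml mulr_sumr -big_split; apply: eq_bigr => j _ /=.
by rewrite mderivM tofracD !tofracM mulrDr mulrA (mulrCA p%:F).
Qed.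

(** The quotient rule, for the numerator and denominator of a representative. *)
Definition frac_der c f : L :=
  (mpoly_der c \n_(repr f) - f * mpoly_der c \d_(repr f)) / (\d_(repr f))%:F.

Lemma frac_der_rep c f p q : q != 0 -> p%:F = f * q%:F ->
  frac_der c f = (mpoly_der c p - f * mpoly_der c q) / q%:F.
Proof.
move=> q0 pE; rewrite /frac_der.
have pE' : (\n_(repr f))%:F = f * (\d_(repr f))%:F.
  by rewrite {2}(fracE f) mulfVK // tofrac_eq0; exact: denom_ratioP.
have q0' : \d_(repr f) != 0 by exact: denom_ratioP.
move: (\n_(repr f)) (\d_(repr f)) pE' q0' => p' q' pE' q0'.
have E : p' * q = p * q'.
  by apply/eqP; rewrite -tofrac_eq !tofracM pE pE' mulrAC.
apply: quotient_rule_eq; rewrite ?tofrac_eq0 //.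
by have := congr1 (mpoly_der c) E; rewrite !mpoly_derM pE pE'.
Qed.

Lemma frac_derE c p q : q != 0 ->
  frac_der c (p%:F / q%:F) = (mpoly_der c p - p%:F / q%:F * mpoly_der c q) / q%:F.
Proof. by move=> q0; apply: frac_der_rep; rewrite // mulfVK // tofrac_eq0. Qed.

Lemma frac_derF c p : frac_der c p%:F = mpoly_der c p.
Proof.
rewrite -[p%:F]divr1 -[1]tofrac1 frac_derE ?oner_neq0 // tofrac1 !divr1.
rewrite [X in _ - _ * X]big1 ?mulr0 ?subr0 // => j _.
by rewrite -[1]mpolyC1 mderivC tofrac0 mulr0.
Qed.

Let fracP f : exists p q, q != 0 /\ p%:F = f * q%:F.
Proof.
exists \n_(repr f), \d_(repr f); have d0 := denom_ratioP (repr f).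
by split=> //; rewrite {2}(fracE f) mulfVK // tofrac_eq0.
Qed.

Lemma frac_derD c f g : frac_der c (f + g) = frac_der c f + frac_der c g.
Proof.
have [p [q [q0 pE]]] := fracP f; have [p' [q' [q0' pE']]] := fracP g.
have qF : q%:F != 0 by rewrite tofrac_eq0.
have qF' : q'%:F != 0 by rewrite tofrac_eq0.
rewrite (frac_der_rep c q0 pE) (frac_der_rep c q0' pE').
rewrite (@frac_der_rep c (f + g) (p * q' + p' * q) (q * q')) ?mulf_neq0 //.
  rewrite mpoly_derD !mpoly_derM pE pE' tofracM.
  exact: (quotient_ruleD _ _ _ _ f g qF qF').
by rewrite tofracD !tofracM pE pE' mulrDl !mulrA [g * _ * _]mulrAC.
Qed.

Lemma frac_derM c f g : frac_der c (f * g) = frac_der c f * g + f * frac_der c g.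
Proof.
have [p [q [q0 pE]]] := fracP f; have [p' [q' [q0' pE']]] := fracP g.
have qF : q%:F != 0 by rewrite tofrac_eq0.
have qF' : q'%:F != 0 by rewrite tofrac_eq0.
rewrite (frac_der_rep c q0 pE) (frac_der_rep c q0' pE').
rewrite (@frac_der_rep c (f * g) (p * p') (q * q')) ?mulf_neq0 //.
  rewrite !mpoly_derM pE pE' tofracM.
  exact: (quotient_ruleM _ _ _ _ f g qF qF').
by rewrite !tofracM pE pE' mulrACA.
Qed.

Lemma frac_der_cst c (a : k) : frac_der c (cst n a) = 0.
Proof.
by rewrite frac_derF /mpoly_der big1 // => j _; rewrite mderivC tofrac0 mulr0.
Qed.

Lemma frac_derX c i : frac_der c ('X_i)%:F = c i.
Proof.
rewrite frac_derF /mpoly_der (bigD1 i) //= big1 => [|j ji]; rewrite mderivX mnmE.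
  have -> : (U_(i) - U_(i) = 0)%MM by apply/mnmP=> j; rewrite !mnmE subnn.
  by rewrite eqxx scale1r mpolyX0 tofrac1 mulr1 addr0.
by rewrite eq_sym (negPf ji) scale0r tofrac0 mulr0.
Qed.

Lemma frac_der_lin c f :
  frac_der c f = \sum_j c j * frac_der (fun i => (i == j)%:R) f.
Proof.
have dE p : mpoly_der c p = \sum_j c j * mpoly_der (fun i => (i == j)%:R) p.
  apply: eq_bigr => j _; congr (_ * _); rewrite /mpoly_der (bigD1 j) //= eqxx.
  by rewrite mul1r big1 ?addr0 // => i /negPf->; rewrite mul0r.
rewrite /frac_der !dE mulr_sumr -sumrB mulr_suml; apply: eq_bigr => j _.
by rewrite mulrCA -mulrBr mulrA.
Qed.

Canonical frac_derivation c := Derivation (frac_derD c) (frac_derM c).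

Definition ev m (T : 'I_m -> L) : {mpoly k[m]} -> L := mmap (cst n) T.
HB.instance Definition _ m (T : 'I_m -> L) :=
  GRing.RMorphism.copy (ev T) (mmap (cst n) T).

Lemma evC m (T : 'I_m -> L) a : ev T a%:MP = cst n a.
Proof. exact: mmapC. Qed.

Lemma evX m (T : 'I_m -> L) i : ev T 'X_i = T i.
Proof. by rewrite /ev mmapX mmap1U. Qed.

(** The chain rule. *)
Lemma frac_der_ev c m (T : 'I_m -> L) P :
  frac_der c (ev T P) = \sum_i ev T P^`M(i) * frac_der c (T i).
Proof.
elim/mpoly_ring_ind: P => [a|i|P Q IHP IHQ|P Q IHP IHQ].
- rewrite evC frac_der_cst big1 // => i _.
  by rewrite mderivC rmorph0 mul0r.
- rewrite (bigD1 i) //= big1 => [|j ji]; rewrite mderivX mnmE.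
    have -> : (U_(i) - U_(i) = 0)%MM by apply/mnmP=> j; rewrite !mnmE subnn.
    by rewrite eqxx scale1r mpolyX0 rmorph1 mul1r addr0 evX.
  by rewrite eq_sym (negPf ji) scale0r rmorph0 mul0r.
- rewrite rmorphD frac_derD IHP IHQ -big_split; apply: eq_bigr => i _ /=.
  by rewrite mderivD rmorphD mulrDl.
rewrite rmorphM frac_derM IHP IHQ mulr_suml mulr_sumr -big_split.
apply: eq_bigr => i _ /=; rewrite mderivM rmorphD !rmorphM mulrDl.
by rewrite [_ * _ * ev T Q]mulrAC [ev T P * (_ * _)]mulrA.
Qed.

(** Jacobian criterion: with as many elements as variables, independence follows
    once no non-zero derivation over k kills them all. A relation of least
    degree would, by differentiation, make the partial derivatives of the
    relation a vector in the kernel of the Jacobian matrix, hence zero; being of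
    smaller degree they vanish as polynomials, and the relation is constant. *)
Lemma jacobian_criterion (T : 'I_n -> L) :
  (forall c, (forall i, frac_der c (T i) = 0) -> forall j, c j = 0) ->
  forall P, ev T P = 0 -> P = 0.
Proof.
move=> der0.
pose J := \matrix_(j < n, i < n) frac_der (fun l => (l == j)%:R) (T i).
have uJ : J \in unitmx.
  rewrite -row_free_unit; apply: inj_row_free => v vJ.
  apply/rowP=> j; rewrite mxE; apply: (der0 (v 0)) => i.
  rewrite frac_der_lin; have /rowP/(_ i) := vJ; rewrite !mxE => {2}<-.
  by apply: eq_bigr => l _; rewrite mxE.
move=> P; have [m] := ubnP (msize P); elim: m P => [|m IH] P sP P0.
  by move: sP; rewrite ltn0.
have dP0 i : P^`M(i) = 0.
  have [->|Pn0] := eqVneq P 0; first by rewrite mderiv0.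
  apply: IH.
    apply: leq_trans (sP : msize P <= m)%N.
    have sP0 : (0 < msize P)%N by rewrite lt0n mmeasure_poly_eq0.
    rewrite -(prednK sP0) ltnS msizeE big_tnth; apply/bigmax_leqP=> j _.
    move: (tnth _ _) (mem_tnth j (in_tuple (msupp P^`M(i)))) => {j} u /=.
    rewrite mcoeff_msupp mcoeff_deriv => u0.
    have : (u + U_(i))%MM \in msupp P.
      by rewrite mcoeff_msupp; apply: contraNneq u0 => ->; rewrite mul0rn.
    by move/msize_mdeg_lt; rewrite mdegD mdeg1 addn1 -{1}(prednK sP0).
  pose V := \col_i ev T P^`M(i).
  suff : V = 0 by move/colP/(_ i); rewrite !mxE.
  apply: (can_inj (mulKmx uJ)); rewrite mulmx0; apply/colP=> j.
  transitivity (frac_der (fun l => (l == j)%:R) (ev T P)).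
    by rewrite frac_der_ev !mxE; apply: eq_bigr => l _; rewrite !mxE mulrC.
  by rewrite P0 mxE -[in LHS](rmorph0 (cst n)) frac_der_cst.
have PC : P = (P@_0)%:MP.
  apply/mpolyP=> u; rewrite mcoeffC.
  have [->|u0] := eqVneq u 0%MM; first by rewrite mulr1.
  have [i ui] : exists i, u i != 0%N.
    by apply/existsP; apply: contraNT u0 => /existsPn u0; apply/eqP/mnmP=> i;
       rewrite mnmE; apply/eqP; rewrite -[_ == _]negbK u0.
  have uE : u = (u - U_(i) + U_(i))%MM.
    by apply/mnmP=> j; rewrite !mnmE subnK //; case: eqVneq => // <-; rewrite lt0n.
  have /mpolyP/(_ (u - U_(i))%MM) := dP0 i.
  rewrite mcoeff_deriv -uE mcoeff0 => /eqP.
  by rewrite mulr0 -mulr_natr mulf_eq0 pnatr_eq0 orbF => /eqP.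
move: P0; rewrite PC evC => /eqP; rewrite fmorph_eq0 => /eqP->.
by rewrite mpolyC0.
Qed.

End Derivation.

(** * A rationality criterion *)

(** If f = a(z)/b(z) is fixed, the polynomial a - f b vanishes on the whole orbit
    of z; after reduction modulo p it has smaller degree than the orbit has
    elements, so it is zero and f is a quotient of coefficients of a and b. *)
Lemma fixed_field_generated (F L : fieldType) (phi : {rmorphism F -> L})
    (I : Type) (s : I -> {rmorphism L -> L}) (Y : seq L) (z f : L)
    (p a b : {poly F}) :
  uniq Y -> (forall y, y \in Y -> exists i, s i z = y) ->
  (forall i x, s i (phi x) = phi x) ->
  p != 0 -> (size p <= (size Y).+1)%N -> root (map_poly phi p) z ->
  (map_poly phi b).[z] != 0 -> f = (map_poly phi a).[z] / (map_poly phi b).[z] ->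
  (forall i, s i f = f) -> exists x, phi x = f.
Proof.
move=> uY Yz sphi p0 sp /rootP pz bz fE sf.
have modE (q : {poly F}) : (map_poly phi q).[z] = (map_poly phi (q %% p)).[z].
  by rewrite {1}(divp_eq q p) rmorphD rmorphM hornerD hornerM pz mulr0 add0r.
rewrite modE in bz; have {}fE : f * (map_poly phi (b %% p)).[z] = (map_poly phi (a %% p)).[z].
  by rewrite fE -!modE mulfVK // modE.
have smod (q : {poly F}) : (size (q %% p)%R <= size Y)%N.
  by rewrite -ltnS; apply: leq_trans sp; rewrite ltn_modp.
move: (a %% p) (b %% p) (smod a) (smod b) fE bz => {}a {}b sa sb fE bz.
pose q := map_poly phi a - f *: map_poly phi b.
have q0 : q = 0.
  apply: (@roots_geq_poly_eq0 _ _ Y) => //.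
    apply/allP => y /Yz[i <-]; rewrite /root /q !hornerE.
    have mapE (r : {poly F}) : (map_poly phi r).[s i z] = s i (map_poly phi r).[z].
      rewrite -horner_map -map_poly_comp; congr _.[_].
      by apply: eq_map_poly => x /=; rewrite sphi.
    by rewrite !mapE -[X in X * _](sf i) -rmorphM fE subrr.
  rewrite /q; apply: leq_trans (size_polyD _ _) _; rewrite size_polyN geq_max.
  rewrite size_map_poly sa /=; apply: leq_trans (size_scale_leq _ _) _.
  by rewrite size_map_poly.
have b0 : b != 0 by apply: contraNneq bz => ->; rewrite rmorph0 horner0.
exists (a`_(size b).-1 / lead_coef b); rewrite fmorph_div.
apply: canLR (mulfK _) _; first by rewrite fmorph_eq0 lead_coef_eq0.
have /polyP/(_ (size b).-1)/eqP := q0; rewrite coef0 coefB coefZ !coef_map.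
by rewrite subr_eq0 => /eqP.
Qed.

Section Adjunction.

Variables (F L : fieldType) (phi : {rmorphism F -> L}) (z : L).

(** The subfield generated by z and the image of phi. *)
Definition adjunction : {pred L} := fun f => `[< exists a b : {poly F},
  (map_poly phi b).[z] != 0 /\ f = (map_poly phi a).[z] / (map_poly phi b).[z] >].

Lemma adjunctionP f : reflect (exists a b : {poly F},
  (map_poly phi b).[z] != 0 /\ f = (map_poly phi a).[z] / (map_poly phi b).[z])
  (f \in adjunction).
Proof. exact: asboolP. Qed.

Fact adjunction_divring : divring_closed adjunction.
Proof.
split=> [|f g|f g].
- by apply/adjunctionP; exists 1, 1; rewrite rmorph1 hornerC oner_eq0 divr1.
- move=> /adjunctionP[a [b [b0 ->]]] /adjunctionP[a' [b' [b0' ->]]].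
  apply/adjunctionP; exists (a * b' - a' * b), (b * b').
  rewrite rmorphB !rmorphM hornerD hornerN !hornerM mulf_neq0 //; split=> //.
  by rewrite -mulNr addf_div // mulNr.
- move=> /adjunctionP[a [b [b0 ->]]] /adjunctionP[a' [b' [b0' ->]]].
  apply/adjunctionP; have [->|a0'] := eqVneq (map_poly phi a').[z] 0.
    exists 0, 1; rewrite rmorph1 hornerC oner_eq0; split=> //.
    by rewrite mul0r invr0 mulr0 rmorph0 horner0 mul0r.
  exists (a * b'), (b * a'); rewrite !rmorphM !hornerM mulf_neq0 //; split=> //.
  by rewrite invf_div mulf_div.
Qed.

HB.instance Definition _ :=
  GRing.isDivringClosed.Build L adjunction adjunction_divring.

Lemma adjunction_base x : phi x \in adjunction.
Proof.
apply/adjunctionP; exists x%:P, 1.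
by rewrite rmorph1 !map_polyC !hornerC oner_eq0 divr1.
Qed.

Lemma adjunction_gen : z \in adjunction.
Proof.
apply/adjunctionP; exists 'X, 1.
by rewrite rmorph1 map_polyX hornerX hornerC oner_eq0 divr1.
Qed.

End Adjunction.

Lemma relation_polyOver (k L : fieldType) (c : {rmorphism k -> L})
    (E : divringClosed L) (t : L) (N D : {poly k}) :
  (forall a, c a \in E) -> t \in E ->
  map_poly c N - t *: map_poly c D \is a polyOver E.
Proof.
move=> Ec Et; apply/polyOverP=> i; rewrite coefB coefZ !coef_map /=.
by rewrite rpredB // rpredM.
Qed.

Section Criterion.

Variables (k : numClosedFieldType) (n : nat).
Local Notation L := {fraction {mpoly k[n.+1]}}.
Local Notation X j := (('X_j : {mpoly k[n.+1]})%:F).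

Lemma ev_closed (E : divringClosed L) m (T : 'I_m -> L) P :
  (forall a, cst n.+1 a \in E) -> (forall i, T i \in E) -> ev T P \in E.
Proof.
move=> Ek ET; elim/mpoly_ring_ind: P => [a|i|P Q EP EQ|P Q EP EQ].
- by rewrite evC.
- by rewrite evX.
- by rewrite rmorphD rpredD.
- by rewrite rmorphM rpredM.
Qed.

Definition proj_field : {pred L} := fun f => `[< proj_function_field f >].

Lemma proj_fieldP f : reflect (proj_function_field f) (f \in proj_field).
Proof. exact: asboolP. Qed.

Fact proj_field_divring : divring_closed proj_field.
Proof.
split=> [|f g|f g].
- apply/proj_fieldP; exists 0%N, 1, 1; rewrite !dhomog1 oner_eq0.
  by split=> //; rewrite tofrac1 divr1.
- move=> /proj_fieldP[d [p [q [hp hq q0 ->]]]].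
  move=> /proj_fieldP[e [p' [q' [hp' hq' q0' ->]]]].
  apply/proj_fieldP; exists (d + e)%N, (p * q' + (- p') * q), (q * q').
  rewrite -mulNr -tofracN frac_addE // mulf_neq0 // dhomogM //; split=> //.
  apply: rpredD; first exact: dhomogM.
  by rewrite addnC; apply: dhomogM; rewrite ?rpredN.
- move=> /proj_fieldP[d [p [q [hp hq q0 ->]]]].
  move=> /proj_fieldP[e [p' [q' [hp' hq' q0' ->]]]].
  apply/proj_fieldP; have [->|p0'] := eqVneq p' 0.
    exists 0%N, 0, 1; rewrite dhomog0 dhomog1 oner_eq0; split=> //.
    by rewrite !tofrac0 mul0r invr0 mulr0 mul0r.
  exists (d + e)%N, (p * q'), (q * p').
  rewrite mulf_neq0 // !dhomogM //; split=> //.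
  by rewrite invf_div frac_mulE.
Qed.

HB.instance Definition _ :=
  GRing.isDivringClosed.Build L proj_field proj_field_divring.

Lemma proj_field_cst a : cst n.+1 a \in proj_field.
Proof.
apply/proj_fieldP; exists 0%N, (a%:MP), 1; rewrite dhomog1 oner_eq0.
split=> //; last by rewrite tofrac1 divr1.
by rewrite -[a%:MP]mulr1 mul_mpolyC dhomogZ // dhomog1.
Qed.

Lemma tofrac_mpolyX_neq0 j : X j != 0.
Proof. by rewrite tofrac_eq0 -msize_poly_eq0 msizeX. Qed.

Lemma homog_dehomog d p : p \is d.-homog ->
  p%:F = ev (fun j => X j / X ord0) p * X ord0 ^+ d.
Proof.
move=> /dhomogP hp; rewrite {1}(mpolyE p) rmorph_sum /ev /mmap mulr_suml.
rewrite [LHS]big_seq [RHS]big_seq; apply: eq_bigr => m /hp <-.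
rewrite -mul_mpolyC rmorphM -mulrA; congr (_ * _).
rewrite mpolyXE_id !rmorph_prod /= mdegE -prodrXr -big_split /=.
apply: eq_bigr => j _; rewrite !rmorphXn /= -exprMn mulfVK //.
exact: tofrac_mpolyX_neq0.
Qed.

Lemma proj_field_sub (E : divringClosed L) :
  (forall a, cst n.+1 a \in E) -> (forall j, X j / X ord0 \in E) ->
  {subset proj_field <= E}.
Proof.
move=> Ek EX f /proj_fieldP[d [p [q [hp hq _ ->]]]].
rewrite (homog_dehomog hp) (homog_dehomog hq) -mulf_div divff ?mulr1.
  by rewrite rpred_div //; apply: ev_closed.
by rewrite expf_neq0 // tofrac_mpolyX_neq0.
Qed.

Variables (gT : finGroupType) (G : {group gT}) (rG : mx_representation k G n.+1).
Local Notation sigma g := (frac_act (rG g)).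

(** The element z generates the function field of the projective space over k(T),
    and the relation N(z) = T i0 * D(z) has degree at most the number of conjugates
    of z. Both the independence of T and its generating the invariants follow. *)
Variables (z : L) (T : 'I_n -> L) (i0 : 'I_n) (N D : {poly k}) (c : k).
Let Y := undup [seq sigma g z | g <- enum G].

Hypothesis T_proj : forall i, T i \in proj_field.
Hypothesis T_fixed : forall i g, g \in G -> sigma g (T i) = T i.
Hypothesis T_gen : forall E : divringClosed L,
  (forall a, cst n.+1 a \in E) -> (forall i, T i \in E) -> z \in E ->
  forall j, X j / X ord0 \in E.
Hypothesis N_size : (size N <= (size Y).+1)%N.
Hypothesis D_size : (size D <= (size Y).+1)%N.
Hypothesis T_neq0 : T i0 != 0.
Hypothesis Nc : root N c.
Hypothesis Dc : ~~ root D c.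
Hypothesis zE : (map_poly (cst n.+1) N).[z] = T i0 * (map_poly (cst n.+1) D).[z].

Let rel_poly := map_poly (cst n.+1) N - T i0 *: map_poly (cst n.+1) D.

(* N - T i0 D is not the zero polynomial: only N vanishes at c. *)
Let rel_poly_neq0 : rel_poly != 0.
Proof.
apply: contraNneq Dc => /(congr1 (fun p => p.[cst n.+1 c])).
rewrite /rel_poly !hornerE !horner_map (rootP Nc) rmorph0 sub0r.
by move/eqP; rewrite oppr_eq0 mulf_eq0 (negPf T_neq0) fmorph_eq0.
Qed.

Let rel_poly_root : root rel_poly z.
Proof. by rewrite /root /rel_poly !hornerE zE subrr. Qed.

Lemma frac_pchar0 : [pchar L] =i pred0.
Proof. by move=> p; rewrite (fmorph_pchar (cst n.+1)) pchar_num. Qed.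

(** Adding one coordinate to T gives as many elements as variables. A derivation that
    kills them all also kills z, which is algebraic over k(T i0), and then the whole
    field. *)
Lemma criterion_independent P : ev T P = 0 -> P = 0.
Proof.
pose T' (i : 'I_n.+1) := oapp T (X ord0) (unlift ord0 i).
pose widen : {mpoly k[n]} -> {mpoly k[n.+1]} :=
  mmap (@mpolyC n.+1 k) (fun i => 'X_(lift ord0 i)).
pose shrink : {mpoly k[n.+1]} -> {mpoly k[n]} :=
  mmap (@mpolyC n k) (fun i => oapp (fun j => 'X_j) 0 (unlift ord0 i)).
have widenK : cancel widen shrink.
  elim/mpoly_ring_ind=> [a|i|p q Hp Hq|p q Hp Hq].
  - by rewrite /widen mmapC /shrink mmapC.
  - by rewrite /widen /shrink mmapX mmap1U mmapX mmap1U liftK.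
  - by rewrite /widen /shrink !rmorphD /= -/(widen _) -/(shrink _) Hp -/(widen _) -/(shrink _) Hq.
  - by rewrite /widen /shrink !rmorphM /= -/(widen _) -/(shrink _) Hp -/(widen _) -/(shrink _) Hq.
have widenE p : ev T' (widen p) = ev T p.
  elim/mpoly_ring_ind: p => [a|i|p q Hp Hq|p q Hp Hq].
  - by rewrite /widen mmapC !evC.
  - by rewrite /widen mmapX mmap1U !evX /T' liftK.
  - by rewrite /widen !rmorphD /= -/(widen _) Hp -/(widen _) Hq.
  - by rewrite /widen !rmorphM /= -/(widen _) Hp -/(widen _) Hq.
rewrite -widenE => /(jacobian_criterion _) P0.
rewrite -(widenK P) P0 /shrink ?mmap0 // => d dT j.
pose E : divringClosed L := der_const (frac_derivation d).
have Ek a : cst n.+1 a \in E by apply/eqP; exact: frac_der_cst.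
have EX0 : X ord0 \in E.
  by apply/eqP; have := dT ord0; rewrite /T' unlift_none.
have ET i : T i \in E.
  by apply/eqP; have := dT (lift ord0 i); rewrite /T' liftK.
have relE : rel_poly \is a polyOver E by exact: relation_polyOver Ek (ET i0).
have Ez : z \in E.
  exact: (der_const_algebraic frac_pchar0 relE rel_poly_neq0 rel_poly_root).
have /rpredM/(_ EX0) := T_gen Ek ET Ez j.
by rewrite mulfVK ?tofrac_mpolyX_neq0 // => /eqP; rewrite /= frac_derX.
Qed.

(** Evaluation at T embeds the rational function field, and an invariant fraction in z
    over its image lies in the image, as the relation for z is short enough. *)
Theorem rationality_criterion : proj_quotient_rational rG.
Proof.
have ev_inj : injective (ev T).
  move=> P Q /eqP; rewrite -subr_eq0 -rmorphB => /eqP/criterion_independent/eqP.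
  by rewrite subr_eq0 => /eqP.
have [phi phiF] := frac_extend ev_inj; exists phi.
have {}phiF p : phi p%:F = ev T p by exact: phiF.
split=> [a|f].
  by rewrite phiF evC.
have phi_proj x : phi x \in proj_field.
  elim/frac_ind: x => p q _; rewrite fmorph_div !phiF.
  by rewrite rpred_div // ev_closed //; exact: proj_field_cst.
have uG g : g \in G -> rG g \in unitmx by exact: repr_mx_unit.
have phi_fixed g x : g \in G -> sigma g (phi x) = phi x.
  move=> gG; have [h hE] := frac_act_lift (uG g gG).
  elim/frac_ind: x => p q _; rewrite hE fmorph_div !phiF.
  have hev P : h (ev T P) = ev T P.
    elim/mpoly_ring_ind: P => [a|i|P Q IP IQ|P Q IP IQ].
    - by rewrite evC -hE frac_act_cst // uG.
    - by rewrite evX -hE T_fixed.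
    - by rewrite !rmorphD IP IQ.
    - by rewrite !rmorphM IP IQ.
  by rewrite fmorph_div !hev.
split=> [[f_proj f_fixed]|[x <-]]; last first.
  by split=> [|g gG]; [apply/proj_fieldP; exact: phi_proj | exact: phi_fixed].
have phi_cst a : cst n.+1 a = phi (cst n a) by rewrite phiF evC.
pose E : divringClosed L := adjunction phi z.
have : f \in E.
  apply: proj_field_sub; last exact: (introT (proj_fieldP f) f_proj).
    by move=> a; rewrite phi_cst; exact: adjunction_base.
  apply: T_gen => [a|i|]; last exact: adjunction_gen.
    by rewrite phi_cst; exact: adjunction_base.
  by rewrite -evX -phiF; exact: adjunction_base.
move=> /adjunctionP[a [b [b0 fE]]].
pose p := map_poly (cst n) N - ('X_i0)%:F *: map_poly (cst n) D.
have pE : map_poly phi p = rel_poly.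
  rewrite rmorphB /= map_polyZ phiF evX -!map_poly_comp.
  by congr (_ - _ *: _); apply: eq_map_poly => y /=; rewrite phi_cst.
have /boolp.choice[s sE] : forall g : {g | g \in G},
    exists h : {rmorphism L -> L}, forall f, sigma (sval g) f = h f.
  by move=> [g gG]; exact: frac_act_lift (uG g gG).
have Yz y : y \in Y -> exists g, s g z = y.
  rewrite mem_undup => /mapP[g]; rewrite mem_enum => gG ->.
  by exists (exist _ g gG); rewrite -sE.
have s_phi g x : s g (phi x) = phi x.
  by case: g => g gG; rewrite -sE /= phi_fixed.
have p_neq0 : p != 0.
  by apply: contraNneq rel_poly_neq0 => p0; rewrite -pE p0 rmorph0.
have p_size : (size p <= (size Y).+1)%N.
  apply: leq_trans (size_polyD _ _) _.
  rewrite size_polyN geq_max size_map_poly N_size /=.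
  by apply: leq_trans (size_scale_leq _ _) _; rewrite size_map_poly.
have p_root : root (map_poly phi p) z by rewrite pE.
have s_f g : s g f = f by case: g => g gG; rewrite -sE /= f_fixed.
exact: (fixed_field_generated (undup_uniq _) Yz s_phi p_neq0 p_size p_root b0 fE
          s_f).
Qed.

End Criterion.

(** * Kernel vectors *)

Section KernelVector.

(** The signed maximal minors of A. *)
Definition kvec (R : comNzRingType) n (A : 'M[R]_(n.+1, n)) : 'rV[R]_n.+1 :=
  \row_i cofactor (row_mx (0 : 'cV_n.+1) A : 'M_(1 + n)) i 0.

Lemma kvec_cofactor (R : comNzRingType) n (r : 'cV[R]_n.+1) (A : 'M[R]_(n.+1, n)) i :
  cofactor (row_mx r A : 'M_(1 + n)) i 0 = kvec A 0 i.
Proof.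
rewrite mxE /cofactor; congr (_ * \det _); apply/matrixP=> a b; rewrite !mxE.
by case: split_ordP => // j; rewrite ord1 => /eqP; rewrite eq_sym (negPf (neq_lift _ _)).
Qed.

Let row_mx_col0 (R : comNzRingType) n (r : 'cV[R]_n.+1) (A : 'M[R]_(n.+1, n)) i :
  (row_mx r A : 'M_(n.+1, 1 + n)) i (0 : 'I_(1 + n)) = r i 0.
Proof.
rewrite mxE; case: split_ordP => j; first by move=> _; rewrite ord1.
by move/(congr1 val).
Qed.

Lemma det_row_kvec (R : comNzRingType) n (r : 'cV[R]_n.+1) (A : 'M[R]_(n.+1, n)) :
  \det (row_mx r A : 'M_(1 + n)) = (kvec A *m r) 0 0.
Proof.
rewrite (expand_det_col _ 0) mxE; apply: eq_bigr => i _.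
by rewrite kvec_cofactor mulrC row_mx_col0.
Qed.

Lemma kvec_mul (R : comNzRingType) n (A : 'M[R]_(n.+1, n)) : kvec A *m A = 0.
Proof.
apply/rowP=> j; rewrite [RHS]mxE.
have -> : (kvec A *m A) 0 j = (kvec A *m col j A) 0 0.
  by rewrite !mxE; apply: eq_bigr => i _; rewrite !mxE.
rewrite -det_row_kvec -det_tr.
apply: (@determinant_alternate _ _ _ 0 (rshift 1 j)) => // i.
by rewrite [LHS]mxE [RHS]mxE row_mx_col0 (row_mxEr (col j A)) mxE.
Qed.

(** A vector in the left kernel is proportional to the vector of minors: multiply it by
    A extended by a unit column, and by the adjugate of that square matrix. *)
Lemma kvec_prop (R : comNzRingType) n (A : 'M[R]_(n.+1, n)) (v : 'rV_n.+1) i j :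
  v *m A = 0 -> v 0 i * kvec A 0 j = v 0 j * kvec A 0 i.
Proof.
move=> vA; pose r : 'cV[R]_n.+1 := delta_mx j 0.
pose B : 'M[R]_(1 + n) := row_mx r A.
have vB : v *m B = v 0 j *: delta_mx 0 0.
  rewrite mul_mx_row vA -colE; apply/rowP=> l; rewrite !mxE.
  case: split_ordP => l' ->; rewrite !mxE ?ord1 /= ?mulr1 //.
  by rewrite mulr0.
have : (v *m B *m \adj B) 0 i = v 0 i * \det B.
  by rewrite -mulmxA mul_mx_adj mul_mx_scalar mxE mulrC.
have adjE : row 0 (\adj B) 0 i = kvec A 0 i by rewrite mxE [LHS]mxE kvec_cofactor.
by rewrite vB -scalemxAl -rowE [LHS]mxE adjE det_row_kvec -colE [(col j _) _ _]mxE.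
Qed.

Lemma map_kvec (R S : comNzRingType) (f : {rmorphism R -> S}) n (A : 'M[R]_(n.+1, n)) :
  map_mx f (kvec A) = kvec (map_mx f A).
Proof.
apply/rowP=> i; rewrite !mxE -cofactor_map_mx; congr cofactor.
by rewrite map_row_mx map_mx0.
Qed.

Lemma rpred_kvec (R : comNzRingType) (E : subringClosed R) n (A : 'M[R]_(n.+1, n)) :
  A \is a mxOver E -> kvec A \is a mxOver E.
Proof.
move=> /mxOverP AE; apply/mxOverP=> a i; rewrite mxE /cofactor rpredM ?rpredX ?rpredN1 //.
rewrite /determinant rpred_sum // => s _; rewrite rpredM ?rpredX ?rpredN1 //.
rewrite rpred_prod // => l _; rewrite !mxE.
by case: split_ordP => l' _; rewrite ?AE // mxE rpred0.
Qed.

(** If one more linear condition makes the left kernel trivial, the kernel is a line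
    and A has maximal rank. *)
Lemma kvec_neq0 (F : fieldType) n (r : 'cV[F]_n.+1) (A : 'M[F]_(n.+1, n)) :
  (forall v : 'rV_n.+1, v *m A = 0 -> v *m r = 0 -> v = 0) -> kvec A != 0.
Proof.
move=> inj; have : (row_mx r A : 'M_(1 + n)) \in unitmx.
  rewrite -row_free_unit; apply: inj_row_free => v.
  by rewrite mul_mx_row -[X in _ = X]row_mx0 => /eq_row_mx[vr vA]; exact: inj.
by rewrite unitmxE det_row_kvec; apply: contraTneq => ->; rewrite mul0mx mxE unitr0.
Qed.

End KernelVector.

(** * Binary forms *)

Section SymmetricPower.

Variable R : comNzRingType.
Implicit Types (A B : 'M[R]_2) (f g : {poly R}).

(** The linear form A i 0 X + A i 1 Y, dehomogenized at X = 1. *)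
Definition linf A (i : 'I_2) : {poly R} := (A i 0)%:P + A i 1 *: 'X.

(** The effect of the substitution by A on the forms of degree n. *)
Definition symmx n A : 'M[R]_n.+1 :=
  \matrix_(i < n.+1) poly_rV (linf A 0 ^+ (n - i) * linf A 1 ^+ i).

(** The homogenization of f in degree n, at (a, b). *)
Definition homeval n f (a b : {poly R}) := \sum_(j < n.+1) f`_j *: (a ^+ (n - j) * b ^+ j).

Lemma homeval_lin n f c d a b : (size f <= n.+1)%N ->
  homeval n.+1 (f * (c%:P + d *: 'X)) a b = homeval n f a b * (c *: a + d *: b).
Proof.
move=> sf; have coefE j : (f * (c%:P + d *: 'X))`_j =
    c * f`_j + d * (if j is j'.+1 then f`_j' else 0).
  rewrite mulrDr coefD coefMC -scalerAr coefZ coefMX mulrC.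
  by case: j => [|j] /=; rewrite ?mulr0.
rewrite /homeval; under eq_bigr => j _ do rewrite coefE scalerDl.
rewrite big_split /= mulrDr; congr (_ + _).
  rewrite big_ord_recr /= (nth_default _ sf) mulr0 scale0r addr0 mulr_suml.
  apply: eq_bigr => j _; rewrite (subSn (leq_ord j)) exprS -!mul_polyC polyCM.
  by ring.
rewrite big_ord_recl /= mulr0 scale0r add0r mulr_suml.
apply: eq_bigr => j _; rewrite /bump /= add1n subSS exprS -!mul_polyC polyCM.
by ring.
Qed.

Lemma size_lin (c d : R) : (size (c%:P + d *: 'X)%R <= 2)%N.
Proof.
apply: leq_trans (size_polyD _ _) _; rewrite geq_max (leq_trans (size_polyC_leq1 _)) //.
by apply: leq_trans (size_scale_leq _ _) _; rewrite size_polyX.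
Qed.

Lemma size_lin_exp f m : (size f <= 2)%N -> (size (f ^+ m)%R <= m.+1)%N.
Proof.
move=> sf; apply: leq_trans (size_poly_exp_leq _ _) _; rewrite ltnS.
by rewrite -[X in (_ <= X)%N]mul1n leq_mul2r -subn1 leq_subLR sf orbT.
Qed.

Lemma size_mul_lin_exp f g m n : (size f <= 2)%N -> (size g <= 2)%N ->
  (size (f ^+ m * g ^+ n)%R <= (m + n).+1)%N.
Proof.
move=> sf sg; apply: leq_trans (size_polyMleq _ _) _.
rewrite -subn1 leq_subLR add1n -addSn -addnS.
by apply: leq_add; exact: size_lin_exp.
Qed.

Lemma homeval_prod A m p a b :
  homeval (m + p) (linf A 0 ^+ m * linf A 1 ^+ p) a b =
  (A 0 0 *: a + A 0 1 *: b) ^+ m * (A 1 0 *: a + A 1 1 *: b) ^+ p.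
Proof.
elim: p => [|p IH].
  rewrite addn0 !mulr1; elim: m => [|m IH].
    by rewrite /homeval big_ord_recl big_ord0 coef1 /= scale1r mulr1 addr0.
  rewrite !exprSr homeval_lin ?IH //.
  by apply: size_lin_exp; exact: size_lin.
rewrite addnS !exprSr !mulrA homeval_lin ?IH //.
by apply: size_mul_lin_exp; exact: size_lin.
Qed.

Lemma symmxE n A i j : symmx n A i j = (linf A 0 ^+ (n - i) * linf A 1 ^+ i)`_j.
Proof. by rewrite !mxE. Qed.

Lemma symmx_poly n A (c : 'rV_n.+1) :
  rVpoly (c *m symmx n A) = homeval n (rVpoly c) (linf A 0) (linf A 1).
Proof.
rewrite mulmx_sum_row linear_sum; apply: eq_bigr => i _.
rewrite linearZ /= coef_rVpoly_ord rowK poly_rV_K //.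
apply: leq_trans (size_mul_lin_exp _ _ _ _) _; try exact: size_lin.
by rewrite subnK ?leq_ord.
Qed.

Lemma linfM A B i : linf (A *m B) i = A i 0 *: linf B 0 + A i 1 *: linf B 1.
Proof.
rewrite /linf !mxE !big_ord_recl !big_ord0 !addr0 -!mul_polyC !rmorphD !rmorphM /=.
rewrite (_ : lift 0 0 = 1) //; [ring | exact/val_inj].
Qed.

Lemma symmxM n A B : symmx n (A *m B) = symmx n A *m symmx n B.
Proof.
apply/row_matrixP=> i; apply: (can_inj rVpolyK).
rewrite row_mul symmx_poly !rowK !poly_rV_K.
- by have := homeval_prod A (n - i) i (linf B 0) (linf B 1);
     rewrite (subnK (leq_ord i)) !linfM.
- apply: leq_trans (size_mul_lin_exp _ _ _ _) _; try exact: size_lin.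
  by rewrite subnK ?leq_ord.
- apply: leq_trans (size_mul_lin_exp _ _ _ _) _; try exact: size_lin.
  by rewrite subnK ?leq_ord.
Qed.

Lemma symmx1 n : symmx n 1%:M = 1%:M.
Proof.
apply/matrixP=> i j; rewrite symmxE /linf !mxE /= scale0r scale1r addr0 add0r.
by rewrite expr1n mul1r coefXn eq_sym.
Qed.

Lemma symmxZ n (a : R) A : symmx n (a *: A) = a ^+ n *: symmx n A.
Proof.
have linfZ i : linf (a *: A) i = a *: linf A i.
  by rewrite /linf !mxE -!mul_polyC !polyCM mulrDr !mulrA.
apply/matrixP=> i j; rewrite [RHS]mxE !symmxE !linfZ !exprZn -scalerAl -scalerAr.
by rewrite scalerA -exprD subnK ?leq_ord // coefZ.
Qed.

Lemma rpred_symmx (E : subringClosed R) n A :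
  A \is a mxOver E -> symmx n A \is a mxOver E.
Proof.
move=> /mxOverP AE; apply/mxOverP=> i j; rewrite symmxE.
have lE l : linf A l \is a polyOver E.
  by rewrite rpredD ?polyOverC ?polyOverZ ?polyOverX.
have := rpredM (rpredX (n - i) (lE 0)) (rpredX i (lE 1)).
by move/polyOverP.
Qed.

End SymmetricPower.

Lemma map_symmx (R S : comNzRingType) (f : {rmorphism R -> S}) n (A : 'M[R]_2) :
  map_mx f (symmx n A) = symmx n (map_mx f A).
Proof.
have linf_map i : map_poly f (linf A i) = linf (map_mx f A) i.
  by rewrite /linf rmorphD /= map_polyC map_polyZ map_polyX !mxE.
apply/matrixP=> i j; rewrite mxE !symmxE -coef_map rmorphM !rmorphXn /=.
by rewrite !linf_map.
Qed.

(** * The covariant pencil of a binary quintic *)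

Lemma ord2P (i : 'I_2) : (i == 0) || (i == 1).
Proof. by case: i => [[|[|]]]. Qed.

Lemma det2 (R : comNzRingType) (A : 'M[R]_2) : \det A = A 0 0 * A 1 1 - A 0 1 * A 1 0.
Proof.
rewrite (expand_det_row _ 0) !big_ord_recl big_ord0 addr0 /cofactor !det_mx11 !mxE /=.
rewrite expr0 mul1r expr1 mulN1r mulrN.
by congr (A _ _ * A _ _ - A _ _ * A _ _); apply/val_inj.
Qed.

Section Transvectants.

(** Coefficient of X^(4-k) Y^k in the transvectant (F, b)_1, resp. (F, C)_2, for
    F = X^(5-i) Y^i and for b = X^(1-j) Y^j if j < 2, resp.
    C = X^(3-(j-2)) Y^(j-2) if j >= 2. *)
Definition tcoef (k i j : nat) : int :=
  if (j < 2)%N then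
    if (i + j == k.+1)%N then (j * 5)%:Z - i%:Z else 0
  else if (i + (j - 2) == k.+2)%N then
    (20 * (j - 2) * (j - 2).-1 + 6 * i * i.-1)%:Z - (16 * i * (j - 2))%:Z else 0.

(** Here p and q stand for the derivatives of the linear forms L and M. The bracket is
    homogeneous of one degree more in these than the right-hand side, which the factor
    L q - p M = 1 makes up for; the rest is a polynomial identity. *)
Fact tcoef_line (S : comPzRingType) (L M p q : S) (i : 'I_6) (j : 'I_2) :
  L * q - p * M = 1 ->
  (L ^+ (5 - i) * M ^+ i) *
     (p * L ^+ (1 - j).-1 * M ^+ j *+ (1 - j) + q * L ^+ (1 - j) * M ^+ j.-1 *+ j) *+ 5
  - (p * L ^+ (5 - i).-1 * M ^+ i *+ (5 - i) + q * L ^+ (5 - i) * M ^+ i.-1 *+ i) *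
     (L ^+ (1 - j) * M ^+ j) =
  \sum_(k < 5) (tcoef k i j)%:~R * (L ^+ (4 - k) * M ^+ k).
Proof.
move=> det1; rewrite -[RHS]mulr1 -[X in _ = _ * X]det1.
rewrite !big_ord_recl big_ord0.
case: j => [[|[|]]] //= _; case: i => [[|[|[|[|[|[|]]]]]]] //= _;
  rewrite /tcoef /bump /= ?(addn0, add1n, subSS, subn0); ring.
Qed.

(** The first and the second derivative of L^a M^b. *)
Let power_der (S : comPzRingType) (L M p q : S) a b :=
  p * L ^+ a.-1 * M ^+ b *+ a + q * L ^+ a * M ^+ b.-1 *+ b.

Let power_der2 (S : comPzRingType) (L M p q : S) a b :=
  p ^+ 2 * L ^+ a.-2 * M ^+ b *+ (a * a.-1)
  + p * q * L ^+ a.-1 * M ^+ b.-1 *+ (2 * a * b)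
  + q ^+ 2 * L ^+ a * M ^+ b.-2 *+ (b * b.-1).

(** The same for the second transvectant, with the square of L q - p M. *)
Fact tcoef_cubic (S : comPzRingType) (L M p q : S) (i : 'I_6) (j : 'I_4) :
  L * q - p * M = 1 ->
  (L ^+ (5 - i) * M ^+ i) * power_der2 L M p q (3 - j) j *+ 20
  - power_der L M p q (5 - i) i * power_der L M p q (3 - j) j *+ 16
  + power_der2 L M p q (5 - i) i * (L ^+ (3 - j) * M ^+ j) *+ 6 =
  \sum_(k < 5) (tcoef k i j.+2)%:~R * (L ^+ (4 - k) * M ^+ k).
Proof.
move=> det1; rewrite -[RHS]mulr1 -[X in _ = _ * X](expr1n _ 2).
rewrite -[X in _ = _ * X ^+ _]det1.
rewrite !big_ord_recl big_ord0 /power_der /power_der2.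
case: j => [[|[|[|[|]]]]] //= _; case: i => [[|[|[|[|[|[|]]]]]]] //= _;
  rewrite /tcoef /bump /= ?(addn0, add1n, subSS, subn0); ring.
Qed.

Variable R : comNzRingType.
Implicit Types (A : 'M[R]_2) (c : 'rV[R]_6) (u : 'rV[R]_(2 + 4)).

(** A quintic c and a pair u = (b, C) of a linear and a cubic form have the
    quartic (c, b)_1 + (c, C)_2, which is u *m trans_mx c = c *m trans_mx' u. *)
Definition trans_mx c : 'M[R]_(2 + 4, 5) :=
  \matrix_(j, k) \sum_(i < 6) (tcoef k i j)%:~R * c 0 i.

Definition trans_mx' u : 'M[R]_(6, 5) :=
  \matrix_(i, k) \sum_(j < 2 + 4) (tcoef k i j)%:~R * u 0 j.

Lemma trans_mxC c u : u *m trans_mx c = c *m trans_mx' u.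
Proof.
apply/rowP=> k; rewrite !mxE.
under eq_bigr => j _ do rewrite mxE mulr_sumr.
rewrite exchange_big; apply: eq_bigr => i _ /=; rewrite mxE mulr_sumr.
by apply: eq_bigr => j _; ring.
Qed.

Let transvectant (f b g : {poly R}) : {poly R} :=
  f * b^`() *+ 5 - f^`() * b + (f * g^`()^`() *+ 20 - f^`() * g^`() *+ 16 + f^`()^`() * g *+ 6).

(** In the dehomogenized variable the transvectants are differential expressions, and
    a substitution of determinant one amounts to replacing 1 and X by linear forms L
    and M with Wronskian one. By bilinearity it is enough to consider monomials. *)
Lemma transvectant_homeval A c u : \det A = 1 ->
  let ev n (v : 'rV_n.+1) := homeval n (rVpoly v) (linf A 0) (linf A 1) in
  transvectant (ev 5%N c) (ev 1%N (lsubmx u)) (ev 3%N (rsubmx u)) =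
  ev 4%N (u *m trans_mx c).
Proof.
move=> detA /=; set L := linf A 0; set M := linf A 1.
set p := (A 0 1)%:P; set q := (A 1 1)%:P.
have det1 : L * q - p * M = 1.
  have : (\det A)%:P = 1 :> {poly R} by rewrite detA.
  by rewrite det2 polyCB !polyCM => <-; rewrite /L /M /p /q /linf -!mul_polyC; ring.
have dL : L^`() = p by rewrite /L /linf derivD derivC derivZ derivX add0r alg_polyC.
have dM : M^`() = q by rewrite /M /linf derivD derivC derivZ derivX add0r alg_polyC.
have dmono a b : (L ^+ a * M ^+ b)^`() = power_der L M p q a b.
  rewrite derivM !deriv_exp dL dM /power_der mulrnAl mulrnAr.
  by congr (_ + _ *+ _); ring.
have ddmono a b : (L ^+ a * M ^+ b)^`()^`() = power_der2 L M p q a b.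
  have dC r x (l : nat) : (r%:P * x *+ l)^`() = r%:P * x^`() *+ l.
    by rewrite derivMn derivM derivC mul0r add0r.
  rewrite dmono /power_der -!mulrA derivD !dC !dmono /power_der /power_der2.
  move: (L ^+ a.-2) (L ^+ a.-1) (L ^+ a) (M ^+ b.-2) (M ^+ b.-1) (M ^+ b).
  by move: a.-1 b.-1 => *; ring.
pose H n (j : 'I_n.+1) := L ^+ (n - j) * M ^+ j.
have evE n (v : 'rV_n.+1) : homeval n (rVpoly v) L M = \sum_j (v 0 j)%:P * H n j.
  by apply: eq_bigr => j _; rewrite coef_rVpoly_ord mul_polyC.
have dZ (r : R) x : (r%:P * x)^`() = r%:P * x^`() by rewrite derivM derivC mul0r add0r.
have devE n (v : 'rV_n.+1) :
    (homeval n (rVpoly v) L M)^`() = \sum_j (v 0 j)%:P * (H n j)^`().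
  by rewrite evE raddf_sum; apply: eq_bigr => j _ /=; rewrite dZ.
have ddevE n (v : 'rV_n.+1) :
    (homeval n (rVpoly v) L M)^`()^`() = \sum_j (v 0 j)%:P * (H n j)^`()^`().
  by rewrite devE raddf_sum; apply: eq_bigr => j _ /=; rewrite dZ.
have prodE n m (v : 'rV_n.+1) (w : 'rV_m.+1) (x : 'I_n.+1 -> {poly R}) (y : 'I_m.+1 -> {poly R}) :
    (\sum_j (v 0 j)%:P * x j) * (\sum_j (w 0 j)%:P * y j) =
    \sum_j \sum_i (w 0 j * v 0 i)%:P * (x i * y j).
  rewrite mulr_sumr; apply: eq_bigr => j _; rewrite mulr_suml.
  by apply: eq_bigr => i _; rewrite polyCM; ring.
rewrite /transvectant !ddevE !devE !evE !prodE -!sumrMnl -!sumrN -!big_split /=.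
transitivity (\sum_(j < 2 + 4) \sum_(i < 6) (u 0 j * c 0 i)%:P *
    \sum_(k < 5) (tcoef k i j)%:~R * (L ^+ (4 - k) * M ^+ k)).
  rewrite big_split_ord /=; congr (_ + _); apply: eq_bigr => j _.
    rewrite -!sumrMnl -sumrN -big_split; apply: eq_bigr => i _ /=.
    rewrite mxE -(tcoef_line i j det1) !dmono /power_der /H; ring.
  rewrite -!sumrMnl -sumrN -!big_split; apply: eq_bigr => i _ /=.
  rewrite mxE -(tcoef_cubic i j det1) !ddmono !dmono /H; ring.
have -> : \sum_(k < 5) ((u *m trans_mx c) 0 k)%:P * H 4%N k =
   \sum_(k < 5) \sum_(j < 2 + 4) \sum_(i < 6) (u 0 j * c 0 i)%:P * ((tcoef k i j)%:~R * H 4%N k).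
  apply: eq_bigr => k _; rewrite mxE rmorph_sum mulr_suml; apply: eq_bigr => j _ /=.
  rewrite mxE mulr_sumr rmorph_sum mulr_suml; apply: eq_bigr => i _ /=.
  by rewrite !polyCM rmorph_int; ring.
rewrite [RHS]exchange_big; apply: eq_bigr => j _ /=.
rewrite [RHS]exchange_big; apply: eq_bigr => i _ /=.
by rewrite mulr_sumr.
Qed.

(** The substitution on pairs of a linear and a cubic form. *)
Definition sym13 A : 'M[R]_(2 + 4) := block_mx A 0 0 (symmx 3 A).

Lemma symmx_1 A : symmx 1 A = A.
Proof.
apply/matrixP=> i j; rewrite symmxE /linf.
by case/orP: (ord2P i) => /eqP->; case/orP: (ord2P j) => /eqP->;
   rewrite /= ?expr1 ?mulr1 ?mul1r coefD coefC coefZ coefX /= ?mulr1 ?mulr0 ?addr0 ?add0r.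
Qed.

Lemma trans_mx_equivariant A c u : \det A = 1 ->
  (u *m sym13 A) *m trans_mx (c *m symmx 5 A) = (u *m trans_mx c) *m symmx 4 A.
Proof.
move=> detA; have ev1 n (v : 'rV[R]_n.+1) :
    homeval n (rVpoly v) (linf 1%:M 0) (linf 1%:M 1) = rVpoly v.
  by rewrite -symmx_poly symmx1 mulmx1.
apply: (can_inj rVpolyK); rewrite symmx_poly -(transvectant_homeval _ _ detA).
rewrite -ev1 -(transvectant_homeval _ _ (det1 _ _)) !ev1 symmx_poly.
have -> : lsubmx (u *m sym13 A) = lsubmx u *m symmx 1 A.
  by rewrite symmx_1 -{1}[u]hsubmxK mul_row_block mulmx0 addr0 row_mxKl.
have -> : rsubmx (u *m sym13 A) = rsubmx u *m symmx 3 A.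
  by rewrite -{1}[u]hsubmxK mul_row_block !mulmx0 add0r row_mxKr.
by rewrite !symmx_poly.
Qed.

End Transvectants.

(** * Two test quintics *)

Section TestQuintics.

Variable k : numFieldType.

(** The quintics X^3 Y^2 + e X^2 Y^3 with e^2 = 1, and the pairs matching them. Their
    linear forms X + e Y have different zeros for e = 1 and e = -1, so that the zero of
    the linear covariant is not constant. *)
Definition test_quintic (e : k) : 'rV[k]_6 :=
  \row_i nth 0 [:: 0; 0; 1; e; 0; 0] i.

Definition test_pair (e : k) : 'rV[k]_(2 + 4) :=
  \row_j nth 0 [:: 10; 10 * e; 0; -1; e; 0] j.

Let sum6 (V : nmodType) (F : 'I_6 -> V) :
  \sum_i F i = F (inord 0) + (F (inord 1) + (F (inord 2) + (F (inord 3) +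
    (F (inord 4) + F (inord 5))))).
Proof.
rewrite !big_ord_recl big_ord0 addr0.
by do !congr (_ + _); congr F; apply/val_inj; rewrite /= inordK.
Qed.

Let trans_test (e : k) (u : 'rV[k]_(2 + 4)) (l : 'I_5) :
  (u *m trans_mx (test_quintic e)) 0 l =
  nth 0 [:: 12 * u 0 (inord 2);
    - 2 * u 0 (inord 0) + 36 * e * u 0 (inord 2) - 20 * u 0 (inord 3);
    - 3 * e * u 0 (inord 0) + 3 * u 0 (inord 1) - 12 * e * u 0 (inord 3)
      - 12 * u 0 (inord 4);
    2 * e * u 0 (inord 1) - 20 * e * u 0 (inord 4) + 36 * u 0 (inord 5);
    12 * e * u 0 (inord 5)] l.
Proof.
rewrite mxE (sum6 (fun j => _)).
rewrite !mxE !sum6 !mxE !inordK //=.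
case: l => [[|[|[|[|[|]]]]]] //= _; rewrite /tcoef /= ?(subSS, subn0); ring.
Qed.

Let row6 (v : 'rV[k]_6) : (forall i, (i < 6)%N -> v 0 (inord i) = 0) -> v = 0.
Proof. by move=> v0; apply/rowP=> i; rewrite mxE -(inord_val i) v0. Qed.

Let test_pairE e j : (j < 6)%N ->
  test_pair e 0 (inord j) = nth 0 [:: 10; 10 * e; 0; -1; e; 0] j.
Proof. by move=> j6; rewrite mxE inordK. Qed.

Lemma test_pair_trans e : e ^+ 2 = 1 -> test_pair e *m trans_mx (test_quintic e) = 0.
Proof.
move=> e2; apply/rowP=> l; rewrite trans_test !test_pairE // mxE /=.
case: l => [[|[|[|[|[|]]]]]] //= _; try by ring.
Qed.

Lemma kvec_test_quintic e : e ^+ 2 = 1 -> kvec (trans_mx (test_quintic e)) != 0.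
Proof.
move=> e2; have e0 : e != 0 by apply: contra_eq_neq e2 => ->; rewrite expr0n eq_sym oner_eq0.
apply: (@kvec_neq0 _ _ (delta_mx (inord 0) 0)) => v vM; rewrite -colE => /colP/(_ 0).
rewrite !mxE => v0.
have E l : (v *m trans_mx (test_quintic e)) 0 l = 0 by rewrite vM mxE.
have nz n (x : k) : n.+1%:R * x = 0 -> x = 0.
  by move/eqP; rewrite mulf_eq0 pnatr_eq0 => /eqP.
have v2 : v 0 (inord 2) = 0 by have := E 0; rewrite trans_test /= => /nz.
have v3 : v 0 (inord 3) = 0.
  by apply: (@nz 19); rewrite -[LHS]opprK -[RHS]oppr0 -(E 1) trans_test /= v0 v2; ring.
have v5 : v 0 (inord 5) = 0.
  apply: (mulfI e0); rewrite mulr0; apply: (@nz 11); rewrite -[RHS](E (Ordinal (isT : (4 < 5)%N))).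
  by rewrite trans_test /=; ring.
have v4 : v 0 (inord 4) = 0.
  apply: (mulfI e0); rewrite mulr0; apply: (@nz 35).
  pose E' l := (v *m trans_mx (test_quintic e)) 0 l.
  transitivity (2 * e * E' (Ordinal (isT : (2 < 5)%N)) - 3 * E' (Ordinal (isT : (3 < 5)%N))).
    by rewrite /E' !trans_test /= v0 v3 v5; ring.
  by rewrite /E' !E; ring.
have v1 : v 0 (inord 1) = 0.
  apply: (@nz 2); rewrite -[RHS](E (Ordinal (isT : (2 < 5)%N))) trans_test /=.
  by rewrite v0 v3 v4; ring.
by apply: row6 => -[|[|[|[|[|[|]]]]]].
Qed.

Lemma kvec_test_pair : kvec (trans_mx' (test_pair 1)) != 0.
Proof.
apply: (@kvec_neq0 _ _ (delta_mx (inord 2) 0)) => v vM; rewrite -colE => /colP/(_ 0).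
rewrite !mxE => v2.
have nz n (x : k) : n.+1%:R * x = 0 -> x = 0.
  by move/eqP; rewrite mulf_eq0 pnatr_eq0 => /eqP.
have vE (l : 'I_5) : (v *m trans_mx' (test_pair 1)) 0 l =
    nth 0 [:: 90 * v 0 (inord 0) + 6 * v 0 (inord 1);
    48 * v 0 (inord 1); 18 * (v 0 (inord 2) - v 0 (inord 3));
    - (48 * v 0 (inord 4)); - (6 * v 0 (inord 4) + 90 * v 0 (inord 5))] l.
  rewrite mxE sum6 !mxE !(sum6 (fun j => _)) !test_pairE // !inordK //=.
  by case: l => [[|[|[|[|[|]]]]]] //= _; rewrite /tcoef /= ?(subSS, subn0); ring.
have E (l : 'I_5) : (v *m trans_mx' (test_pair 1)) 0 l = 0 by rewrite vM mxE.
have {}vE l := etrans (esym (vE l)) (E l).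
have v1 : v 0 (inord 1) = 0 by exact: nz (vE 1).
have v0 : v 0 (inord 0) = 0.
  by apply: (@nz 89); rewrite -[RHS](vE 0) /= v1; ring.
have v3 : v 0 (inord 3) = 0.
  by have := nz _ _ (vE (Ordinal (isT : (2 < 5)%N))); rewrite /= v2 sub0r => /eqP; rewrite oppr_eq0 => /eqP.
have v4 : v 0 (inord 4) = 0 by have /eqP := vE (Ordinal (isT : (3 < 5)%N)); rewrite /= oppr_eq0 => /eqP/nz.
have v5 : v 0 (inord 5) = 0.
  by apply: (@nz 89); rewrite -[RHS]oppr0 -[in RHS](vE (Ordinal (isT : (4 < 5)%N))) /= v4; ring.
by apply: row6 => -[|[|[|[|[|[|]]]]]].
Qed.

End TestQuintics.

(** * Moving frames *)

Lemma rpred_det (R : comNzRingType) (E : subringClosed R) n (A : 'M[R]_n) :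
  A \is a mxOver E -> \det A \in E.
Proof.
move=> /mxOverP AE; rewrite rpred_sum // => s _.
by rewrite rpredM ?rpredX ?rpredN1 // rpred_prod.
Qed.

Lemma rpred_adj (R : comNzRingType) (E : subringClosed R) n (A : 'M[R]_n) :
  A \is a mxOver E -> \adj A \is a mxOver E.
Proof.
move=> /mxOverP AE; apply/mxOverP=> i j; rewrite mxE rpredM ?rpredX ?rpredN1 //.
by apply: rpred_det; apply/mxOverP=> a b; rewrite !mxE.
Qed.

Lemma kvecZ (R : comNzRingType) n (a : R) (A : 'M[R]_(n.+1, n)) :
  kvec (a *: A) = a ^+ n *: kvec A.
Proof.
apply/rowP=> i; rewrite !mxE /cofactor -[X in row_mx X (a *: _)](scaler0 _ a) -scale_row_mx.
have -> : row' i (col' 0 (a *: row_mx 0 A : 'M_(1 + n))) =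
    a *: row' i (col' 0 (row_mx 0 A : 'M_(1 + n))) by apply/matrixP=> ? ?; rewrite !mxE.
by rewrite detZ mulrCA.
Qed.

Section MovingFrame.

Variables (k : numClosedFieldType) (L : fieldType) (c : {rmorphism k -> L}).
Variables (gT : finGroupType) (G : {group gT}) (rho : gT -> 'M[k]_2).
Hypothesis rhoM : {in G &, forall g h, rho (g * h)%g = rho g *m rho h}.
Hypothesis rho1 : rho 1%g = 1%:M.
Hypothesis det_rho : {in G, forall g, \det (rho g) = 1}.
Variable z : L.
Hypothesis z_trans : forall a, z != c a.

Local Notation rhoL g := (map_mx c (rho g)).

(** As k is algebraically closed, an element outside of k is transcendental. *)
Lemma horner_neq0 (p : {poly k}) : p != 0 -> (map_poly c p).[z] != 0.
Proof.
have [s ->] := closed_field_poly_normal p => p0.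
rewrite map_polyZ hornerZ mulf_neq0 ?fmorph_eq0 //.
  by apply: contraNneq p0 => ->; rewrite scale0r.
rewrite rmorph_prod horner_prod prodf_seq_neq0; apply/allP=> a _ /=.
by rewrite rmorphB /= map_polyX map_polyC hornerXsubC subr_eq0 z_trans.
Qed.

Lemma lin_neq0 a b : (a != 0) || (b != 0) -> c a * z + c b != 0.
Proof.
move=> ab; have := @horner_neq0 (a *: 'X + b%:P).
rewrite rmorphD /= map_polyZ map_polyX map_polyC !hornerE; apply.
apply: contraTneq ab => /polyP p0.
have := p0 0%N; have := p0 1%N; rewrite !coefE !mulr1 !mulr0 addr0 add0r => -> ->.
by rewrite eqxx.
Qed.

(** The linear form z X + Y and its images. *)
Definition point g : 'rV[L]_2 := \row_j (c (rho g 0 j) * z + c (rho g 1 j)).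
Definition moebius g : L := point g 0 0 / point g 0 1.

Lemma pointE g : point g = point 1%g *m rhoL g.
Proof.
apply/rowP=> j; rewrite !mxE !big_ord_recl big_ord0 !mxE rho1 !mxE /= !rmorph0 !rmorph1.
rewrite (_ : lift 0 0 = 1); last exact/val_inj.
by rewrite !(mul0r, mul1r, addr0, add0r) [z * _]mulrC.
Qed.

Lemma point_mul g h : g \in G -> h \in G -> point (h * g)%g = point h *m rhoL g.
Proof. by move=> gG hG; rewrite pointE rhoM // map_mxM mulmxA -pointE. Qed.

Lemma point_neq0 g : g \in G -> point g 0 1 != 0.
Proof.
move=> gG; rewrite mxE lin_neq0 //; apply: contraTT (oner_neq0 k).
rewrite negb_or !negbK => /andP[/eqP r0 /eqP r1]; rewrite -(det_rho gG) det2 r0 r1.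
by rewrite mulr0 mul0r subrr eqxx.
Qed.

Lemma point1_0 : point 1%g 0 0 = z.
Proof. by rewrite !mxE rho1 !mxE /= rmorph0 rmorph1 mul1r addr0. Qed.

Lemma point1_1 : point 1%g 0 1 = 1.
Proof. by rewrite !mxE rho1 !mxE /= rmorph0 rmorph1 mul0r add0r. Qed.

Lemma moebius1 : moebius 1%g = z.
Proof. by rewrite /moebius point1_0 point1_1 divr1. Qed.

(** A fixed point equation would be algebraic for z, so it is an identity. *)
Lemma moebius_fix g : g \in G -> moebius g = z ->
  exists2 a, a ^+ 2 = 1 & rho g = a%:M.
Proof.
move=> gG /(canRL (mulfVK (point_neq0 gG))); rewrite !mxE => E.
pose p : {poly k} := rho g 0 1 *: 'X^2 + (rho g 1 1 - rho g 0 0) *: 'X - (rho g 1 0)%:P.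
have p0 : p = 0.
  apply/eqP; apply: contraTT isT => /horner_neq0.
  rewrite /p rmorphB rmorphD /= !map_polyZ map_polyXn map_polyX map_polyC !hornerE.
  move=> /eqP[]; rewrite rmorphB /=; apply/eqP.
  apply/eqP; transitivity
    (z * (c (rho g 0 1) * z + c (rho g 1 1)) - (c (rho g 0 0) * z + c (rho g 1 0))).
    by ring.
  by rewrite E subrr.
have /polyP pE := p0.
have r01 : rho g 0 1 = 0 by have := pE 2%N; rewrite !coefE /= mulr1 mulr0 addr0 subr0.
have r10 : rho g 1 0 = 0.
  by have := pE 0%N; rewrite !coefE /= !mulr0 !add0r => /eqP; rewrite oppr_eq0 => /eqP.
have r11 : rho g 1 1 = rho g 0 0.
  have := pE 1%N; rewrite !coefE /= mulr0 mulr1 add0r subr0 => /eqP.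
  by rewrite subr_eq0 => /eqP.
exists (rho g 0 0); first by rewrite -(det_rho gG) det2 r01 r11 mul0r subr0.
apply/matrixP=> i j; rewrite mxE.
by case/orP: (ord2P i) => /eqP->; case/orP: (ord2P j) => /eqP->; rewrite ?r01 ?r10 ?r11.
Qed.

Definition frame_row m : 'rV[L]_2 :=
  \sum_(g in G) (point g 0 0 * moebius g ^+ m) *: (delta_mx 0 1 *m rhoL g^-1).

(** The linear form z X + Y completed to a basis that moves along with it: averaging over
    the group makes the second form covariant as well. *)
Definition frame m : 'M[L]_2 := \matrix_(i, j) (if i == 0 then point 1%g 0 j else frame_row m 0 j).

Lemma det_frame m : \det (frame m) = \sum_(g in G) point g 0 0 ^+ 2 * moebius g ^+ m.
Proof.
have row0E j : frame m 0 j = point 1%g 0 j by rewrite mxE.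
have row1E j : frame m 1 j = frame_row m 0 j by rewrite mxE.
rewrite det2 !row0E !row1E.
have -> : frame_row m 0 1 = \sum_(g in G) point g 0 0 * moebius g ^+ m * c (rho g^-1%g 1 1).
  rewrite summxE; apply: eq_bigr => g _; rewrite mxE; congr (_ * _).
  by rewrite -rowE !mxE.
have -> : frame_row m 0 0 = \sum_(g in G) point g 0 0 * moebius g ^+ m * c (rho g^-1%g 1 0).
  rewrite summxE; apply: eq_bigr => g _; rewrite mxE; congr (_ * _).
  by rewrite -rowE !mxE.
rewrite !mulr_sumr -sumrB; apply: eq_bigr => g gG.
have rV : rho g *m rho g^-1 = 1%:M by rewrite -rhoM ?groupV // mulgV.
have pV : point 1%g = point g *m rhoL g^-1 by rewrite -point_mul ?groupV // mulgV.
have dV : c (\det (rho g^-1%g)) = 1 by rewrite det_rho ?groupV // rmorph1.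
rewrite det2 rmorphB !rmorphM /= in dV.
have pE j : point 1%g 0 j = point g 0 0 * c (rho g^-1%g 0 j) + point g 0 1 * c (rho g^-1%g 1 j).
  rewrite pV mxE !big_ord_recl big_ord0 addr0 !mxE.
  by rewrite (_ : lift 0 0 = 1) //; exact/val_inj.
rewrite !pE; move: (point g 0 0) (point g 0 1) (moebius g ^+ m) => a b w.
rewrite -[RHS]mulr1 -dV; ring.
Qed.

Hypothesis L_char0 : [pchar L] =i pred0.

(** If all these determinants vanish, then so does the sum with any polynomial in
    moebius g in place of the powers. A polynomial that vanishes on the orbit of z
    except at z leaves the contribution of the stabilizer, which acts by signs. *)
Lemma exists_frame : exists m, \det (frame m) != 0.
Proof.
apply: contrapT => /forallNP H.
have d0 m : \sum_(g in G) point g 0 0 ^+ 2 * moebius g ^+ m = 0.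
  by rewrite -det_frame; apply/eqP; have /negP := H m; rewrite negbK.
have dp (p : {poly L}) : \sum_(g in G) point g 0 0 ^+ 2 * p.[moebius g] = 0.
  under eq_bigr => g _ do rewrite horner_coef mulr_sumr.
  rewrite exchange_big big1 // => i _ /=.
  transitivity (p`_i * \sum_(g in G) point g 0 0 ^+ 2 * moebius g ^+ i).
    by rewrite mulr_sumr; apply: eq_bigr => g _; rewrite mulrCA.
  by rewrite d0 mulr0.
pose p : {poly L} := \prod_(g in G | moebius g != z) ('X - (moebius g)%:P).
have pz : p.[z] != 0.
  rewrite horner_prod; apply/prodf_neq0 => g /andP[_ gz].
  by rewrite hornerXsubC subr_eq0 eq_sym.
have := dp p; rewrite (bigID (fun g => moebius g == z)) /= [X in _ + X]big1 => [|g /andP[gG gz]].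
  rewrite addr0 (eq_bigr (fun=> z ^+ 2 * p.[z])) => [|g /andP[gG /eqP gz]]; last first.
    have [a a2 ra] := moebius_fix gG gz; rewrite gz !mxE ra !mxE /= rmorph0 addr0.
    by rewrite exprMn -rmorphXn a2 rmorph1 mul1r.
  rewrite sumr_const => /eqP; apply/negP; rewrite -mulr_natr.
  have z0 : z != 0 by rewrite -(rmorph0 c) z_trans.
  rewrite mulf_neq0 ?mulf_neq0 ?expf_neq0 //.
  move/pcharf0P: L_char0 => ->; rewrite -lt0n; apply/card_gt0P; exists 1%g.
  by rewrite unfold_in group1 moebius1 eqxx.
rewrite [X in _ * X](_ : _ = 0) ?mulr0 //; apply/eqP.
rewrite horner_prod (bigD1 g) ?gG //= hornerXsubC subrr mul0r //.
Qed.

Lemma rpred_point (E : divringClosed L) : (forall a, c a \in E) -> z \in E ->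
  forall g j, point g 0 j \in E.
Proof. by move=> Ec Ez g j; rewrite mxE rpredD ?rpredM. Qed.

Lemma rpred_frame (E : divringClosed L) m : (forall a, c a \in E) -> z \in E ->
  frame m \is a mxOver E.
Proof.
move=> Ec Ez; have Ep := rpred_point Ec Ez.
apply/mxOverP=> i j; rewrite mxE; case: ifP => // _.
have Em g : moebius g ^+ m \in E by apply: rpredX; exact: rpred_div.
rewrite summxE rpred_sum // => g _; rewrite mxE; apply: rpredM.
  exact: rpredM (Ep _ _) (Em _).
by rewrite -rowE !mxE.
Qed.

Section Equivariance.

Variables (s : {rmorphism L -> L}) (h : gT).
Hypotheses (hG : h \in G) (sc : forall a, s (c a) = c a) (sz : s z = moebius h).

Local Notation mu := (point h 0 1)^-1.

Lemma map_point g : g \in G -> map_mx s (point g) = mu *: point (h * g)%g.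
Proof.
move=> gG; have E1 : map_mx s (point 1%g) = mu *: point h.
  apply/rowP=> j; rewrite [LHS]mxE [RHS]mxE; case/orP: (ord2P j) => /eqP->.
    by rewrite point1_0 sz mulrC.
  by rewrite point1_1 rmorph1 mulVf ?point_neq0.
rewrite pointE map_mxM E1 -map_mx_comp (eq_map_mx _ (sc : s \o c =1 c)).
by rewrite -scalemxAl point_mul.
Qed.

Lemma map_moebius g : g \in G -> s (moebius g) = moebius (h * g)%g.
Proof.
move=> gG; have /rowP E := map_point gG.
have sE j : s (point g 0 j) = mu * point (h * g)%g 0 j by have := E j; rewrite [LHS]mxE [RHS]mxE.
by rewrite fmorph_div !sE -mulf_div divff ?mul1r // invr_eq0 point_neq0.
Qed.

(** The automorphism of L given by h acts on the frame as the substitution rho h,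
    up to the same scalar as on the first row. *)
Lemma map_frame m : map_mx s (frame m) = mu *: (frame m *m rhoL h).
Proof.
have Ep := map_point (group1 G); rewrite mulg1 in Ep.
apply/row_matrixP=> i; rewrite linearZ /= row_mul.
case/orP: (ord2P i) => /eqP->.
  have rowE0 : row 0 (frame m) = point 1%g by apply/rowP=> j; rewrite !mxE.
  by rewrite -map_row rowE0 Ep -pointE.
have rowE1 : row 1 (frame m) = frame_row m by apply/rowP=> j; rewrite !mxE.
rewrite -map_row rowE1 /frame_row map_mx_sum mulmx_suml scaler_sumr.
rewrite [RHS](reindex_inj (mulgI h)) /=; apply: eq_big => g; first by rewrite groupMl.
move=> gG; have sE j : s (point g 0 j) = mu * point (h * g)%g 0 j.
  by have /rowP/(_ j) := map_point gG; rewrite [LHS]mxE [RHS]mxE.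
rewrite map_mxZ rmorphM rmorphXn /= sE map_moebius // -scalemxAl scalerA mulrA.
congr (_ *: _); rewrite -mulmxA -map_mxM -rhoM ?groupV ?groupM // invMg mulgKV.
rewrite map_mxM map_delta_mx -map_mx_comp; congr (_ *m _).
by apply/matrixP=> a b; rewrite !mxE /= sc.
Qed.

End Equivariance.
End MovingFrame.

(** * Generators of the field of invariants *)

Lemma undup_map (T : Type) (S : eqType) (f : T -> S) (s : seq T) :
  exists2 s', undup (map f s) = map f s' & forall P : pred T, all P s -> all P s'.
Proof.
elim: s => [|x s [s' E IH]]; first by exists [::].
rewrite /= E; case: ifP => _; first by exists s' => // P /andP[_ /IH].
by exists (x :: s') => // P /= /andP[-> /IH].
Qed.

Lemma symmx_unit (F : fieldType) n (A : 'M[F]_2) :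
  A \in unitmx -> symmx n A \in unitmx.
Proof.
by move=> uA; case: (@mulmx1_unit _ _ (symmx n A) (symmx n (invmx A))) => //;
   rewrite -symmxM mulmxV // symmx1.
Qed.

Lemma rpred_invmx (F : fieldType) (E : divringClosed F) n (A : 'M[F]_n) :
  A \is a mxOver E -> invmx A \is a mxOver E.
Proof.
move=> AE; rewrite /invmx; case: ifP => // _; apply/mxOverP=> i j; rewrite mxE.
by rewrite rpredM ?rpredV ?rpred_det //; apply/mxOverP; exact: rpred_adj.
Qed.

Section QuinticInvariants.

Variables (k : numClosedFieldType) (L : fieldType) (c : {rmorphism k -> L}).
Variables (gT : finGroupType) (G : {group gT}) (rho : gT -> 'M[k]_2).
Hypothesis rhoM : {in G &, forall g h, rho (g * h)%g = rho g *m rho h}.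
Hypothesis rho1 : rho 1%g = 1%:M.
Hypothesis det_rho : {in G, forall g, \det (rho g) = 1}.
Hypothesis L_char0 : [pchar L] =i pred0.
Variable s : gT -> {rmorphism L -> L}.
Hypothesis sc : {in G, forall g a, s g (c a) = c a}.

Local Notation rhoL g := (map_mx c (rho g)).

Section OrbitPolynomial.

Variable z : L.
Hypothesis z_trans : forall a, z != c a.
Hypothesis sz : {in G, forall g, s g z = moebius c rho z g}.

Local Notation moeb := (moebius c rho z).
Let Y := undup [seq s g z | g <- enum G].

(** An invariant in k(z), whose degree in z is the size of the orbit. *)
Definition orbit_fun e : L := \prod_(y <- Y) (y - c e).

Let orbit_mem y : y \in Y -> exists2 g, g \in G & y = moeb g.
Proof.
rewrite mem_undup => /mapP[g]; rewrite mem_enum => gG ->.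
by exists g => //; exact: sz.
Qed.

Lemma orbit_fun_fixed e h : h \in G -> s h (orbit_fun e) = orbit_fun e.
Proof.
move=> hG; have sY : perm_eq (map (s h) Y) Y.
  have uY : uniq (map (s h) Y).
    by rewrite map_inj_uniq ?undup_uniq //; exact: fmorph_inj.
  apply: uniq_perm => //; first exact: undup_uniq.
  apply: (uniq_min_size uY _ _).2; last by rewrite size_map.
  move=> _ /mapP[y /orbit_mem[g gG ->] ->].
  have -> : s h (moeb g) = s (h * g)%g z.
    rewrite sz ?groupM //.
    by apply: (map_moebius rhoM rho1 det_rho z_trans hG (sc hG) (sz hG) gG).
  by rewrite mem_undup; apply: map_f; rewrite mem_enum groupM.
rewrite /orbit_fun rmorph_prod -[RHS](perm_big _ sY) big_map.
by apply: eq_bigr => y _; rewrite rmorphB sc.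
Qed.

Lemma orbit_fun_neq0 e : orbit_fun e != 0.
Proof.
rewrite prodf_seq_neq0; apply/allP=> y /orbit_mem[g gG ->] /=.
rewrite subr_eq0 -sz //; apply: contra_neq (z_trans e) => E.
by apply: (fmorph_inj (s g)); rewrite E sc.
Qed.

(** Each factor is a fraction of degree one in z. The constant e is chosen outside the
    zeros of the denominators; the numerator vanishes there, since z itself is in the
    orbit. *)
Lemma orbit_fun_relation : exists e (N D : {poly k}),
  [/\ (size N <= (size Y).+1)%N, (size D <= (size Y).+1)%N, root N e, ~~ root D e &
      (map_poly c N).[z] = orbit_fun e * (map_poly c D).[z]].
Proof.
pose den g : {poly k} := rho g 0 1 *: 'X + (rho g 1 1)%:P.
pose num e g : {poly k} := (rho g 0 0 - e * rho g 0 1) *: 'X + (rho g 1 0 - e * rho g 1 1)%:P.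
have den0 g : g \in G -> den g != 0.
  move=> gG; apply: contra_neq (point_neq0 det_rho z_trans gG) => /(congr1 (map_poly c)).
  move/(congr1 (fun p => p.[z])); rewrite rmorphD /= map_polyZ map_polyX map_polyC.
  by rewrite rmorph0 !hornerE mxE.
have : \prod_(g in G) den g != 0 by apply/prodf_neq0.
move=> /closed_nonrootP[e]; rewrite /root horner_prod => /prodf_neq0 de.
have [r rE rG] := undup_map (fun g => s g z) (enum G).
have {}rG : {subset r <= G}.
  apply/allP; apply: rG; apply/allP=> g; by rewrite mem_enum.
exists e, (\prod_(g <- r) num e g), (\prod_(g <- r) den g).
have sY : size Y = size r by rewrite /Y rE size_map.
have size_prod_lin (f : gT -> {poly k}) : (forall g, size (f g) <= 2)%N ->
    (size (\prod_(g <- r) f g)%R <= (size Y).+1)%N.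
  move=> sf; rewrite sY; elim: (r) => [|g r' IH]; first by rewrite big_nil size_poly1.
  rewrite big_cons; apply: leq_trans (size_polyMleq _ _) _.
  rewrite -subn1 leq_subLR add1n /=.
  by apply: leq_trans (leq_add (sf g) IH) _; rewrite add2n.
split.
- by apply: size_prod_lin => g; rewrite /num addrC size_lin.
- by apply: size_prod_lin => g; rewrite /den addrC size_lin.
- have : z \in map (fun g => s g z) r.
    rewrite -rE mem_undup; apply/mapP; exists 1%g; first by rewrite mem_enum group1.
    by rewrite sz ?group1 // moebius1.
  move=> /mapP[g gr zE]; have gG := rG _ gr.
  have [a _ ra] := moebius_fix det_rho z_trans gG (etrans (esym (sz gG)) (esym zE)).
  rewrite /root horner_prod prodf_seq_eq0; apply/hasP; exists g => //=.
  have [r00 r11 r01 r10] : [/\ rho g 0 0 = a, rho g 1 1 = a, rho g 0 1 = 0 & rho g 1 0 = 0].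
    by rewrite ra !mxE.
  by rewrite /num r00 r11 r01 r10 !hornerE /=; apply/eqP; ring.
- by rewrite /root horner_prod prodf_seq_neq0; apply/allP=> g /rG gG /=; exact: de.
have -> : orbit_fun e = \prod_(g <- r) (moeb g - c e).
  rewrite /orbit_fun /Y rE big_map; rewrite [LHS]big_seq [RHS]big_seq.
  by apply: eq_bigr => g /rG gG; rewrite sz.
rewrite !rmorph_prod !horner_prod -big_split [LHS]big_seq [RHS]big_seq.
apply: eq_bigr => g /rG gG /=.
rewrite !rmorphD /= !map_polyZ !map_polyX !map_polyC !hornerE.
rewrite !rmorphB !rmorphM /=.
have := point_neq0 det_rho z_trans gG; rewrite /moebius.
have -> : c (rho g 0 1) * z + c (rho g 1 1) = point c rho z g 0 1 by rewrite mxE.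
move=> p0; rewrite [RHS]mulrBl mulfVK // !mxE ?rmorphN ?rmorphM /=; ring.
Qed.

End OrbitPolynomial.

Variable y : 'rV[L]_6.
Hypothesis sy : {in G, forall g, map_mx (s g) y = y *m symmx 5 (rhoL g)}.

(** The pair of the linear and the cubic covariant of y. *)
Variable u : 'rV[L]_(2 + 4).
Hypothesis u_def : u = kvec (trans_mx y : 'M_(5.+1, 5)).
Local Notation u1 := (u 0 (lshift 4 1)).
Hypothesis u1_neq0 : u1 != 0.
Local Notation z := (u 0 (lshift 4 0) / u1).
Hypothesis z_trans : forall a, z != c a.
Hypothesis ku_neq0 : kvec (trans_mx' u) != 0.

Let v : 'rV[L]_(2 + 4) := u1^-1 *: u.

Let uE : u *m trans_mx y = 0.
Proof. by rewrite u_def; exact: kvec_mul. Qed.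

Let v_line : lsubmx v = point c rho z 1%g.
Proof.
apply/rowP=> j; case/orP: (ord2P j) => /eqP->.
  by rewrite (point1_0 c rho1) !mxE mulrC.
by rewrite (point1_1 c rho1) !mxE mulVf.
Qed.

(** By equivariance u is covariant up to a scalar, which the normalization of one
    coordinate to 1 determines. *)
Let v_covariant g : g \in G ->
  map_mx (s g) v = (point c rho z g 0 1)^-1 *: (v *m sym13 (rhoL g)).
Proof.
move=> gG; pose su : 'rV[L]_(2 + 4) := map_mx (s g) u; pose ug : 'rV[L]_(2 + 4) := u *m sym13 (rhoL g).
have dg : \det (rhoL g) = 1 by rewrite det_map_mx det_rho // rmorph1.
have suE : su = kvec (trans_mx (y *m symmx 5 (rhoL g))).
  by rewrite /su u_def map_kvec -sy //; congr kvec; apply/matrixP=> i j; rewrite !mxE rmorph_sum;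
     apply: eq_bigr => l _; rewrite rmorphM rmorph_int !mxE.
have ug0 : ug *m trans_mx (y *m symmx 5 (rhoL g)) = 0.
  by rewrite trans_mx_equivariant // uE mul0mx.
have ugE : ug 0 (lshift 4 1) = u1 * point c rho z g 0 1.
  have -> : ug 0 (lshift 4 1) = (lsubmx ug) 0 1 by rewrite [RHS]mxE.
  rewrite /ug -[X in X *m _]hsubmxK mul_row_block mulmx0 addr0 row_mxKl.
  rewrite mxE !big_ord_recl big_ord0 addr0 !mxE.
  rewrite (_ : lift 0 0 = 1); last exact/val_inj.
  rewrite [RHS]mulrDr; congr (_ + _).
  by rewrite [RHS]mulrCA [u1 * _]mulrC mulfVK // mulrC.
have su1 : su 0 (lshift 4 1) = s g u1 by rewrite mxE.
have p0 : point c rho z g 0 1 != 0 by exact: (point_neq0 det_rho z_trans gG).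
have su1_neq0 : su 0 (lshift 4 1) != 0 by rewrite su1 fmorph_eq0.
have ug1_neq0 : ug 0 (lshift 4 1) != 0 by rewrite ugE mulf_neq0.
apply/rowP=> j.
have -> : map_mx (s g) v 0 j = su 0 j / su 0 (lshift 4 1).
  by rewrite su1 [LHS]mxE [v _ _]mxE rmorphM fmorphV mulrC [su _ _]mxE.
have -> : ((point c rho z g 0 1)^-1 *: (v *m sym13 (rhoL g))) 0 j = ug 0 j / ug 0 (lshift 4 1).
  have -> : v *m sym13 (rhoL g) = u1^-1 *: ug by rewrite /v -scalemxAl.
  by rewrite scalerA -invfM (mulrC (point _ _ _ _ _ _)) -ugE [LHS]mxE mulrC.
apply/eqP; rewrite eqr_div //; apply/eqP.
rewrite mulrC suE; symmetry.
exact: (@kvec_prop _ 5 _ ug j (@lshift 2 4 1) ug0).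
Qed.

Let C : 'rV[L]_4 := rsubmx v.

Let C_covariant g : g \in G ->
  map_mx (s g) C = (point c rho z g 0 1)^-1 *: (C *m symmx 3 (rhoL g)).
Proof.
move=> gG; rewrite /C map_rsubmx v_covariant // -{1}[v]hsubmxK mul_row_block.
by rewrite !mulmx0 add0r scale_row_mx row_mxKr.
Qed.

Let trans_mxZ a (x : 'rV[L]_6) : trans_mx (a *: x) = a *: trans_mx x.
Proof.
apply/matrixP=> i j; rewrite !mxE mulr_sumr; apply: eq_bigr => l _.
by rewrite mxE mulrCA.
Qed.

Let rpred_v (E : divringClosed L) : (forall a, c a \in E) ->
  (forall i j, y 0 i / y 0 j \in E) -> v \is a mxOver E.
Proof.
move=> Ec Ey; have /rV0Pn[j0 yj0] : y != 0.
  apply: contra_neq u1_neq0 => y00.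
  have t0 : trans_mx (0 : 'rV[L]_6) = 0 *: trans_mx 0 by rewrite -trans_mxZ scaler0.
  by rewrite u_def y00 t0 (@kvecZ _ 5) expr0n /= scale0r mxE.
pose y' := (y 0 j0)^-1 *: y; pose ky : 'rV[L]_6 := kvec (trans_mx y' : 'M_(5.+1, 5)).
have kyE : ky \is a mxOver E.
  apply: rpred_kvec; apply/mxOverP=> a b; rewrite mxE rpred_sum // => l _.
  by rewrite rpredM ?rpred_int // mxE mulrC.
have uk : u = y 0 j0 ^+ 5 *: ky.
  by rewrite u_def -(@kvecZ _ 5) -trans_mxZ /y' scalerA mulfV // scale1r.
have vk j : v 0 j = ky 0 j / ky 0 (@lshift 2 4 1).
  rewrite mxE uk !mxE mulrC -mulf_div divff ?mul1r // expf_neq0 //.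
by apply/mxOverP=> a j; rewrite ord1 vk rpred_div //; exact/mxOverP.
Qed.

(** The bilinear map is symmetric in its two arguments, so that the quintic is, up to a
    scalar, the kernel vector for the pair v. *)
Let rpred_y (E : divringClosed L) : v \is a mxOver E ->
  forall i j, y 0 i / y 0 j \in E.
Proof.
move=> vE i j; have kE : kvec (trans_mx' v : 'M_(5.+1, 5)) \is a mxOver E.
  apply: rpred_kvec; apply/mxOverP=> a b; rewrite mxE rpred_sum // => l _.
  by rewrite rpredM ?rpred_int //; exact/mxOverP.
have vy : y *m (trans_mx' v : 'M_(5.+1, 5)) = 0.
  by rewrite -trans_mxC -scalemxAl uE scaler0.
have tv : trans_mx' v = u1^-1 *: trans_mx' u.
  apply/matrixP=> a b; rewrite !mxE mulr_sumr; apply: eq_bigr => l _.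
  by rewrite mxE mulrCA.
have /rV0Pn[l kl] : kvec (trans_mx' v : 'M_(5.+1, 5)) != 0.
  apply: contra_neq ku_neq0; rewrite tv (@kvecZ _ 5) => /eqP.
  by rewrite scaler_eq0 expf_eq0 /= invr_eq0 (negPf u1_neq0) => /eqP.
have yk a b := kvec_prop a b vy.
have [->|yj] := eqVneq (y 0 j) 0; first by rewrite invr0 mulr0 rpred0.
have kj : kvec (trans_mx' v : 'M_(5.+1, 5)) 0 j != 0.
  apply: contraNneq yj => kj0; have := yk j l; rewrite kj0 mulr0 => /eqP.
  by rewrite mulf_eq0 (negPf kl) orbF.
have -> : y 0 i / y 0 j = kvec (trans_mx' v : 'M_(5.+1, 5)) 0 i / kvec (trans_mx' v : 'M_(5.+1, 5)) 0 j.
  by apply/eqP; rewrite eqr_div // yk mulrC.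
by rewrite rpred_div //; exact/mxOverP.
Qed.

Let rpred_prod_orbit (E : divringClosed L) e : (forall a, c a \in E) ->
  {in G, forall g, s g z \in E} -> orbit_fun z e \in E.
Proof.
move=> Ec Es; rewrite /orbit_fun big_seq rpred_prod // => x.
rewrite mem_undup => /mapP[g]; rewrite mem_enum => gG ->.
by rewrite rpredB // Es.
Qed.

(** The generators are the function orbit_fun of z, and the four coefficients of the
    cubic covariant in the moving frame; both the cubic and the frame are covariant, so
    the coefficients are invariant once the determinant of the frame corrects the
    scalar. Conversely z, the frame and the coefficients give back the pair v, and
    with it the quintic. *)
Lemma quintic_generators : exists (T : 'I_5 -> L) (e : k) (N D : {poly k}),
  let Y := undup [seq s g z | g <- enum G] in
  [/\ forall g i, g \in G -> s g (T i) = T i,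
      forall E : divringClosed L, (forall a, c a \in E) ->
        (forall i j, y 0 i / y 0 j \in E) -> z \in E /\ forall i, T i \in E,
      forall E : divringClosed L, (forall a, c a \in E) ->
        (forall i, T i \in E) -> z \in E -> forall i j, y 0 i / y 0 j \in E,
      [/\ (size N <= (size Y).+1)%N, (size D <= (size Y).+1)%N, root N e & ~~ root D e] &
      T ord0 != 0 /\ (map_poly c N).[z] = T ord0 * (map_poly c D).[z]].
Proof.
have sz : {in G, forall g, s g z = moebius c rho z g}.
  move=> g gG; have /rowP/(_ (lshift 4 0)) := v_covariant gG.
  have vz : v 0 (lshift 4 0) = z.
    by have /rowP/(_ 0) := v_line; rewrite (point1_0 c rho1) mxE.
  rewrite [LHS]mxE vz => ->; rewrite [LHS]mxE /moebius mulrC; congr (_ / _).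
  have lE (A : 'rV[L]_(2 + 4)) : A 0 (lshift 4 0) = lsubmx A 0 0 by rewrite [RHS]mxE.
  rewrite (lE (v *m _)) -[X in X *m _]hsubmxK mul_row_block mulmx0 addr0 row_mxKl v_line.
  by rewrite -pointE.
have [m] := exists_frame rhoM rho1 det_rho z_trans L_char0.
set R := frame c G rho z m => detR.
have uR : R \in unitmx by rewrite unitmxE unitfE.
have [w wE rpred_w] : exists2 w : 'rV[L]_4, w *m symmx 3 R = \det R *: C &
    forall E : divringClosed L, R \is a mxOver E -> C \is a mxOver E -> w \is a mxOver E.
  exists (\det R *: (C *m symmx 3 (invmx R))) => [|E RE CE].
    by rewrite -scalemxAl -mulmxA -symmxM mulVmx // symmx1 mulmx1.
  by rewrite mxOverZ ?rpred_det // mxOverM ?rpred_symmx ?rpred_invmx.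
have [e [N [D [sN sD Ne De rel]]]] := orbit_fun_relation z_trans sz.
pose T i := oapp (fun j => w 0 j) (orbit_fun z e) (unlift ord0 i).
have T0 : T ord0 = orbit_fun z e by rewrite /T unlift_none.
have TS j : T (lift ord0 j) = w 0 j by rewrite /T liftK.
have TP (P : L -> Prop) : P (orbit_fun z e) -> (forall j, P (w 0 j)) -> forall i, P (T i).
  by move=> P0 PS i; case: (unliftP ord0 i) => [j ->|->]; rewrite ?TS ?T0.
exists T, e, N, D; split.
- move=> g i gG; move: i; apply: (TP (fun x => s g x = x)) => [|j]; first exact: (orbit_fun_fixed z_trans sz).
  suff -> : s g (w 0 j) = map_mx (s g) w 0 j.
    congr (fun_of_matrix _ 0 j); set mu := (point c rho z g 0 1)^-1.
    have mu0 : mu != 0 by rewrite invr_eq0 (point_neq0 det_rho z_trans gG).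
    have dr : \det (rhoL g) = 1 by rewrite det_map_mx det_rho // rmorph1.
    have ur : rhoL g \in unitmx by rewrite unitmxE dr unitr1.
    have uRr := symmx_unit 3 (etrans (unitmx_mul R (rhoL g)) (introT andP (conj uR ur))).
    have mR : map_mx (s g) R = mu *: (R *m rhoL g).
      exact: (map_frame rhoM rho1 det_rho z_trans gG (sc gG) (sz _ gG)).
    apply: (can_inj (mulmxK uRr)); apply: (scalerI (expf_neq0 3 mu0)).
    have := congr1 (map_mx (s g)) wE.
    rewrite map_mxM map_symmx map_mxZ -det_map_mx mR detZ det_mulmx dr mulr1.
    rewrite C_covariant // symmxZ -/mu => E.
    rewrite scalemxAr E symmxM mulmxA wE -scalemxAl !scalerA.
    by congr (_ *: _); ring.
  by rewrite [RHS]mxE.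
- move=> E Ec Ey; have vE := rpred_v Ec Ey.
  have Ez : z \in E by have /mxOverP/(_ 0 (lshift 4 0)) := vE; rewrite mxE mulrC.
  have RE : R \is a mxOver E by exact: rpred_frame.
  split=> //; apply: (TP (fun x => x \in E)) => [|j].
    apply: rpred_prod_orbit => // g gG.
    have Ep := rpred_point rho Ec Ez g.
    by rewrite sz //; exact: (rpred_div (Ep 0) (Ep 1)).
  have wEE : w \is a mxOver E.
    by apply: rpred_w => //; apply/mxOverP=> i l; rewrite mxE; exact/mxOverP.
  by move/mxOverP: wEE.
- move=> E Ec ET Ez; apply: rpred_y => //.
  have RE : R \is a mxOver E by exact: rpred_frame.
  have wEE : w \is a mxOver E.
    by apply/mxOverP=> i j; rewrite ord1 -TS.
  have CE : C \is a mxOver E.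
    have -> : C = (\det R)^-1 *: (w *m symmx 3 R) by rewrite wE scalerA mulVf // scale1r.
    by rewrite mxOverZ ?rpredV ?rpred_det // mxOverM ?rpred_symmx.
  rewrite -[v]hsubmxK v_line -/C; apply/mxOverP=> i j; rewrite mxE.
  case: splitP => l _; last exact/mxOverP.
  by rewrite ord1; exact: rpred_point.
- by split.
- by rewrite T0; split; [exact: (orbit_fun_neq0 z_trans sz) | ].
Qed.

End QuinticInvariants.

(** * Rationality for symmetric fifth powers *)

Lemma map_trans_mx (R S : comNzRingType) (f : {rmorphism R -> S}) (x : 'rV[R]_6) :
  map_mx f (trans_mx x) = trans_mx (map_mx f x).
Proof.
apply/matrixP=> i j; rewrite !mxE rmorph_sum; apply: eq_bigr => l _.
by rewrite rmorphM rmorph_int mxE.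
Qed.

Lemma map_trans_mx' (R S : comNzRingType) (f : {rmorphism R -> S}) (u : 'rV[R]_(2 + 4)) :
  map_mx f (trans_mx' u) = trans_mx' (map_mx f u).
Proof.
apply/matrixP=> i j; rewrite !mxE rmorph_sum; apply: eq_bigr => l _.
by rewrite rmorphM rmorph_int mxE.
Qed.

Section SymmetricFifthPower.

Variables (k : numClosedFieldType) (gT : finGroupType) (G : {group gT}).
Variables (rho : gT -> 'M[k]_2) (rG : mx_representation k G 6) (Q : 'M[k]_6).
Hypothesis rhoM : {in G &, forall g h, rho (g * h)%g = rho g *m rho h}.
Hypothesis rho1 : rho 1%g = 1%:M.
Hypothesis det_rho : {in G, forall g, \det (rho g) = 1}.
Hypothesis uQ : Q \in unitmx.
Hypothesis rGQ : {in G, forall g, rG g *m Q = Q *m symmx 5 (rho g)}.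

Local Notation A := {mpoly k[6]}.
Local Notation L := {fraction A}.

(* The coordinates of the quintic, as linear forms. *)
Let yp : 'rV[A]_6 := \row_j \sum_i Q i j *: 'X_i.
Let up : 'rV[A]_(2 + 4) := kvec (trans_mx yp : 'M_(5.+1, 5)).

Let at_quintic (x : 'rV[k]_6) : {rmorphism A -> k} := meval (fun i => (x *m invmx Q) 0 i).

Let yp_at x : map_mx (at_quintic x) yp = x.
Proof.
apply/rowP=> j; rewrite -[in RHS](mulmxKV uQ x) !mxE rmorph_sum.
by apply: eq_bigr => i _ /=; rewrite mevalZ mevalXU mulrC.
Qed.

Let up_at x : map_mx (at_quintic x) up = kvec (trans_mx x : 'M_(5.+1, 5)).
Proof. by rewrite /up map_kvec map_trans_mx yp_at. Qed.

Section AtTestQuintic.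

Variable e : k.
Hypothesis e2 : e ^+ 2 = 1.

Let kv := kvec (trans_mx (test_quintic e) : 'M_(5.+1, 5)).
Let i0 : 'I_(2 + 4) := lshift 4 0.
Let i1 : 'I_(2 + 4) := lshift 4 1.

Let kv_prop i j : test_pair e 0 i * kv 0 j = test_pair e 0 j * kv 0 i.
Proof. exact: (@kvec_prop _ 5 _ _ i j (test_pair_trans e2)). Qed.

Let tp0 : test_pair e 0 i0 = 10. Proof. by rewrite mxE. Qed.
Let tp1 : test_pair e 0 i1 = 10 * e. Proof. by rewrite mxE. Qed.

Let e0 : e != 0.
Proof. by apply: contra_eq_neq e2 => ->; rewrite expr0n eq_sym oner_eq0. Qed.

Lemma kv1_neq0 : kv 0 i1 != 0.
Proof.
have /rV0Pn[j kj] := kvec_test_quintic e2.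
have := kv_prop i1 j; rewrite tp1 => E; apply: contra_eq_neq E => ->.
by rewrite mulr0 !mulf_neq0 // pnatr_eq0.
Qed.

Lemma kv0_kv1 : kv 0 i1 = e * kv 0 i0.
Proof.
have := kv_prop i0 i1; rewrite tp0 tp1 -mulrA; apply: mulfI.
by rewrite pnatr_eq0.
Qed.

Lemma kv_test_pair : kv = (kv 0 i1 / (10 * e)) *: test_pair e.
Proof.
apply/rowP=> j; rewrite [RHS]mxE -mulrA; apply/(mulfI (_ : 10 * e != 0)).
  by rewrite mulf_neq0 // pnatr_eq0.
rewrite [RHS]mulrCA mulVKf ?mulf_neq0 ?pnatr_eq0 // -tp1 kv_prop mulrC //.
Qed.

End AtTestQuintic.

Local Notation frac := (@FracField.tofrac A).
Let y : 'rV[L]_6 := map_mx frac yp.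
Let u : 'rV[L]_(2 + 4) := map_mx frac up.

Let u_def : u = kvec (trans_mx y : 'M_(5.+1, 5)).
Proof. by rewrite /u map_kvec map_trans_mx. Qed.

Let one2 : (1 : k) ^+ 2 = 1. Proof. exact: expr1n. Qed.
Let mone2 : (-1 : k) ^+ 2 = 1. Proof. by rewrite sqrrN one2. Qed.

Let up1_neq0 : up 0 (lshift 4 1) != 0.
Proof.
apply: contra_neq (kv1_neq0 one2) => up0.
by rewrite -up_at mxE up0 rmorph0.
Qed.

Let u1_neq0 : u 0 (lshift 4 1) != 0.
Proof. by rewrite mxE tofrac_eq0. Qed.

(** The zeros of the linear covariants at the two test quintics differ. *)
Let z_trans a : u 0 (lshift 4 0) / u 0 (lshift 4 1) != cst 6 a.
Proof.
have uE j : u 0 j = frac (up 0 j) by rewrite [LHS]mxE.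
apply/eqP => /(canRL (mulfVK u1_neq0)); rewrite !uE -tofracM => /eqP.
rewrite tofrac_eq => /eqP E.
have Ex x : kvec (trans_mx x : 'M_(5.+1, 5)) 0 (@lshift 2 4 0) =
    a * kvec (trans_mx x : 'M_(5.+1, 5)) 0 (@lshift 2 4 1) :> k.
  by rewrite -up_at [LHS]mxE E rmorphM /= mevalC; congr (_ * _); rewrite [RHS]mxE.
have aE e : e ^+ 2 = 1 -> e * a = 1.
  move=> e2; apply: (mulIf (kv1_neq0 e2)); rewrite -mulrA -Ex mul1r.
  by rewrite [RHS](kv0_kv1 e2).
have a1 := aE 1 one2; have := aE _ mone2; rewrite mulN1r -[a]mul1r a1.
by move/eqP; rewrite eq_sym -subr_eq0 opprK -[1 + 1]/(2%:R) pnatr_eq0.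
Qed.

Let ku_neq0 : kvec (trans_mx' u : 'M_(5.+1, 5)) != 0.
Proof.
suff : kvec (trans_mx' up : 'M_(5.+1, 5)) != 0.
  apply: contra_neq => /(congr1 (fun M : 'rV[L]_6 => M)).
  rewrite /u -map_trans_mx' -map_kvec => /rowP E; apply/rowP=> j.
  by have /eqP := E j; rewrite !mxE tofrac_eq0 => /eqP.
apply: contra_neq (kvec_test_pair k) => /(congr1 (map_mx (at_quintic (test_quintic 1)))).
rewrite map_kvec map_trans_mx' up_at (kv_test_pair one2).
set a := (X in X *: _); have a0 : a != 0.
  by rewrite mulf_neq0 ?kv1_neq0 // invr_eq0 mulr1 pnatr_eq0.
have -> : trans_mx' (a *: test_pair 1) = a *: trans_mx' (test_pair 1).
  apply/matrixP=> i j; rewrite !mxE mulr_sumr; apply: eq_bigr => l _.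
  by rewrite mxE mulrCA.
rewrite (@kvecZ _ 5) map_mx0 => /eqP; rewrite scaler_eq0 expf_eq0 /= (negPf a0).
by move/eqP.
Qed.

Let uG g : g \in G -> rG g \in unitmx. Proof. exact: repr_mx_unit. Qed.

Let y_act (s : {rmorphism L -> L}) g : g \in G -> (forall f, frac_act (rG g) f = s f) ->
  map_mx s y = y *m symmx 5 (map_mx (cst 6) (rho g)).
Proof.
move=> gG sE; rewrite -map_symmx; apply/rowP=> j.
have yE l : y 0 l = \sum_i cst 6 (Q i l) * frac 'X_i.
  rewrite !mxE rmorph_sum; apply: eq_bigr => i _ /=.
  by rewrite -mul_mpolyC tofracM.
rewrite [LHS]mxE [RHS]mxE yE rmorph_sum.
transitivity (\sum_i cst 6 ((rG g *m Q) i j) * frac 'X_i).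
  transitivity (\sum_i \sum_l cst 6 (Q i j * rG g l i) * frac 'X_l).
    apply: eq_bigr => i _; rewrite /= rmorphM -!sE frac_act_cst ?uG // frac_actF ?uG //.
    rewrite mpoly_actX rmorph_sum mulr_sumr; apply: eq_bigr => l _ /=.
    by rewrite -mul_mpolyC tofracM mulrA -rmorphM.
  rewrite exchange_big; apply: eq_bigr => l _ /=; rewrite mxE rmorph_sum mulr_suml.
  by apply: eq_bigr => i _ /=; rewrite [Q i j * _]mulrC.
rewrite rGQ //; transitivity (\sum_i \sum_l cst 6 (Q i l * symmx 5 (rho g) l j) * frac 'X_i).
  by apply: eq_bigr => i _; rewrite mxE rmorph_sum mulr_suml.
rewrite exchange_big; apply: eq_bigr => l _ /=; rewrite yE mulr_suml.
by apply: eq_bigr => i _; rewrite !mxE rmorphM /= mulrAC.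
Qed.

Lemma yp_homog j : yp 0 j \is 1.-homog.
Proof.
rewrite mxE rpred_sum // => i _; rewrite rpredZ //.
by rewrite dhomogX /= mdeg1.
Qed.

(** The generic quintic y of the representation satisfies the assumptions of
    quintic_generators; that the covariants involved do not vanish identically is seen
    at the test quintics. *)
Theorem sym5_rational : proj_quotient_rational rG.
Proof.
have /boolp.choice[s sE] : forall g, exists h : {rmorphism L -> L},
    g \in G -> forall f, frac_act (rG g) f = h f.
  move=> g; have [gG|gG] := boolP (g \in G).
    by have [h hE] := frac_act_lift (uG gG); exists h.
  by exists idfun.
have sc : {in G, forall g a, s g (cst 6 a) = cst 6 a}.
  by move=> g gG a; rewrite -sE // frac_act_cst // uG.
have sy : {in G, forall g, map_mx (s g) y = y *m symmx 5 (map_mx (cst 6) (rho g))}.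
  by move=> g gG; apply: y_act => // f; exact: sE.
have [T [e [N [D [T_fixed T_proj T_gen [sN sD Ne De] [T0 rel]]]]]] :=
  quintic_generators rhoM rho1 det_rho (@frac_pchar0 k 5) sc sy u_def u1_neq0 z_trans ku_neq0.
have YE : [seq s g (u 0 (lshift 4 0) / u 0 (lshift 4 1)) | g <- enum G] =
    [seq frac_act (rG g) (u 0 (lshift 4 0) / u 0 (lshift 4 1)) | g <- enum G].
  by apply/eq_in_map => g; rewrite mem_enum => gG; rewrite sE.
rewrite YE in sN sD.
have /rV0Pn[j0 yj0] : y != 0.
  apply: contra_neq u1_neq0 => y0; have yE : y = 0 *: y by rewrite scale0r.
  rewrite u_def yE.
  have -> : trans_mx (0 *: y) = 0 *: trans_mx y.
    apply/matrixP=> i j; rewrite !mxE mul0r big1 // => l _; rewrite mxE.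
    by rewrite mul0r mulr0.
  by rewrite (@kvecZ _ 5) expr0n /= scale0r mxE.
have y_proj i j : y 0 i / y 0 j \in @proj_field k 5.
  have [->|yj] := eqVneq (y 0 j) 0; first by rewrite invr0 mulr0 rpred0.
  apply/proj_fieldP; exists 1%N, (yp 0 i), (yp 0 j).
  have yE l : y 0 l = frac (yp 0 l) by rewrite [LHS]mxE.
  by rewrite !yp_homog !yE; split=> //; rewrite -tofrac_eq0 -yE.
have [Ez ET] := T_proj (@proj_field k 5) (@proj_field_cst k 5) y_proj.
have T_gen' (E : divringClosed L) : (forall a, cst 6 a \in E) ->
    (forall i, T i \in E) -> u 0 (lshift 4 0) / u 0 (lshift 4 1) \in E ->
    forall j, frac 'X_j / frac 'X_ord0 \in E.
  move=> Ec ETE EzE; have Ey := T_gen E Ec ETE EzE.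
  have xE j : frac 'X_j / y 0 j0 \in E.
    have -> : frac 'X_j = \sum_l y 0 l * cst 6 (invmx Q l j).
      have /rowP/(_ j) : \row_i frac 'X_i = y *m map_mx (cst 6) (invmx Q).
        apply: (can_inj (mulmxK (_ : map_mx (cst 6) Q \in unitmx))).
          by rewrite map_unitmx.
        rewrite -mulmxA -map_mxM mulVmx // map_mx1 mulmx1; apply/rowP=> l.
        rewrite !mxE rmorph_sum; apply: eq_bigr => i _; rewrite !mxE /=.
        by rewrite -mul_mpolyC tofracM mulrC.
      rewrite [LHS]mxE => ->; rewrite [LHS]mxE; apply: eq_bigr => l _.
      by congr (_ * _); rewrite [LHS]mxE.
    rewrite mulr_suml rpred_sum // => l _; rewrite mulrAC.
    exact: rpredM (Ey _ _) (Ec _).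
  move=> j; have := rpred_div (xE j) (xE ord0).
  by rewrite invf_div mulrA mulfVK.
have T_fixed' i g : g \in G -> frac_act (rG g) (T i) = T i.
  by move=> gG; rewrite sE // T_fixed.
exact: (rationality_criterion ET T_fixed' T_gen' sN sD T0 Ne De rel).
Qed.

End SymmetricFifthPower.

(** * Odd representations *)

Section OddRepresentations.

Variables (F : numClosedFieldType) (gT : finGroupType) (G : {group gT}).

Let F'G : ([pchar F]^'.-group G)%g.
Proof. by apply/pgroupP=> p _ _; rewrite inE /= pchar_num. Qed.

Lemma trace_regular_nontrivial x : x \in G -> x != 1%g -> \tr (regular_repr F G x) = 0.
Proof.
move=> xG x1; rewrite /mxtrace big1 // => i _; rewrite /= /regular_mx mxE mxE eqxx /=.
rewrite -[i in (i == _)]gring_valK (inj_in_eq (can_in_inj (@gring_indexK _ G))).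
- by rewrite eq_mulVg1 mulKg (negPf x1).
- exact: enum_valP.
- by rewrite groupM ?enum_valP.
Qed.

(** The determinant is a linear character. *)
Lemma det_derived n (rG : mx_representation F G n) :
  {in G^`(1)%g, forall x, \det (rG x) = 1}.
Proof.
pose dG g : 'M[F]_1 := (\det (rG g))%:M.
have dG_repr : mx_repr G dG.
  split=> [|g h gG hG]; first by rewrite /dG repr_mx1 det1.
  by rewrite /dG repr_mxM // det_mulmx scalar_mxM.
move=> x xG'; have := subsetP (rker_linear (MxRepresentation dG_repr) erefl) x xG'.
by case/rkerP=> _ /matrixP/(_ 0 0) /=; rewrite /dG !mxE.
Qed.

Variable z : gT.
Hypotheses (zZ : z \in 'Z(G)%g) (oz : #[z]%g = 2%N).

Let zG : z \in G. Proof. by case/setIP: zZ. Qed.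

(** Schur's lemma. *)
Lemma central_involution_scalar n (rG : mx_representation F G n) : mx_irreducible rG ->
  rG z = 1%:M \/ rG z = (-1)%:M.
Proof.
move=> irrG; case/setIP: zZ => _ cz.
have absG : mx_absolutely_irreducible rG by exact: group_closure_closed_field.
have /is_scalar_mxP[a za] : is_scalar_mx (rG z).
  apply: (mx_abs_irr_cent_scalar absG); apply/centgmxP=> x xG.
  by rewrite -!repr_mxM // (centP cz).
have z2 : (z * z = 1)%g by rewrite -[RHS](expg_order z) oz expgS expg1.
have n0 : (0 < n)%N by case/mx_irrP: irrG.
have /eqP : a ^+ 2 = 1.
  have := congr1 rG z2; rewrite repr_mxM // repr_mx1 za -scalar_mxM.
  by move/matrixP/(_ (Ordinal n0) (Ordinal n0)); rewrite !mxE eqxx.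
by rewrite sqrf_eq1 za => /orP[/eqP->|/eqP->]; [left | right].
Qed.

Lemma central_involution_repr n (rG : mx_representation F G n) :
  mx_irreducible rG -> mx_faithful rG -> rG z = (-1)%:M.
Proof.
move=> irrG fG; case: (central_involution_scalar irrG) => // z1.
have : z \in rker rG by rewrite !inE zG mul1mx z1 eqxx.
by move/(subsetP fG); rewrite inE -order_eq1 oz.
Qed.

Let sG : irrType F G := DecSocleType (regular_repr F G).

(** The regular character vanishes at z, so that the odd and the even
    irreducible representations account for half the order of G each. *)
Lemma sum_odd_degree :
  ((\sum_(i : sG | irr_repr i z == (-1)%:M) irr_degree i ^ 2).*2 = #|G|)%N.
Proof.
pose odd (i : sG) := irr_repr i z == (-1)%:M.
have splitG : group_splitting_field F G by exact: group_closure_closed_field.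
apply: etrans (sum_irr_degree_pchar sG F'G splitG).
rewrite [in RHS](bigID odd) /= -addnn; congr (_ + _)%N.
apply/eqP; rewrite -(eqr_nat F) !natr_sum eq_sym -subr_eq0; apply/eqP.
transitivity (\tr (regular_repr F G z)); last first.
  by rewrite trace_regular_nontrivial // -order_eq1 oz.
rewrite (mxtrace_regular_pchar sG F'G splitG zG) [RHS](bigID odd) /= addrC -sumrN.
congr (_ + _); apply: eq_bigr => i oi.
  rewrite -irr_reprE; have [->|zi] := central_involution_scalar (socle_irr i).
    by rewrite mxtrace1 -mulrnA mulnn.
  by rewrite /odd zi eqxx in oi.
by rewrite (eqP oi) mxtrace_scalar mulNrn mulNrn -mulrnA mulnn.
Qed.

Lemma odd_rsim n m (rG : mx_representation F G n) (rS : mx_representation F G m) :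
  mx_rsim rG rS -> rG z = (-1)%:M -> rS z = (-1)%:M.
Proof.
move=> /mx_rsim_sym[B _ freeB homB] zG1; apply: (row_free_inj freeB).
by rewrite homB // zG1 mul_mx_scalar mul_scalar_mx.
Qed.

(** There is no room for two different odd representations of degree n in a space of
    dimension less than 2 n^2. *)
Lemma odd_irreducible_rsim n (rG rS : mx_representation F G n) :
  rG z = (-1)%:M -> rS z = (-1)%:M -> (#|G| < 4 * n ^ 2)%N ->
  mx_irreducible rG -> mx_irreducible rS -> mx_rsim rG rS.
Proof.
move=> rGz rSz ltG irrG irrS.
have simG := rsim_irr_comp_pchar sG F'G irrG; have simS := rsim_irr_comp_pchar sG F'G irrS.
have [eqGS|neqGS] := eqVneq (irr_comp sG rG) (irr_comp sG rS).
  by apply: mx_rsim_trans simG _; rewrite eqGS; exact: mx_rsim_sym.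
have degG : n = irr_degree (irr_comp sG rG) by case: simG.
have degS : n = irr_degree (irr_comp sG rS) by case: simS.
move: ltG; rewrite -sum_odd_degree ltnNge; case/negP.
rewrite (bigD1 (irr_comp sG rG)) /=; last by apply/eqP; exact: odd_rsim simG rGz.
rewrite (bigD1 (irr_comp sG rS)) /=; last first.
  by rewrite [_ == irr_comp sG rG]eq_sym neqGS andbT; apply/eqP; exact: odd_rsim simS rSz.
by rewrite -degG -degS addnA addnn doubleD -!mul2n !mulnA leq_addr.
Qed.

(** The squares of the degrees of the odd irreducible representations add up to 60, of
    which degree 6 takes 36. The degrees are even, because -1 must have determinant 1;
    without degree 2, the remaining 24 would be a multiple of 16. *)
Lemma odd_irreducible_degree2 (rG : mx_representation F G 6) :
  mx_irreducible rG -> rG z = (-1)%:M -> #|G| = 120%N -> z \in G^`(1)%g ->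
  exists rS : mx_representation F G 2, rS z = (-1)%:M.
Proof.
move=> irrG rGz cardG zG'.
have evn (i : sG) : irr_repr i z = (-1)%:M -> ~~ odd (irr_degree i).
  move=> oi; have /eqP := det_derived (irr_repr i) zG'.
  rewrite oi det_scalar -signr_odd; case: odd => //=.
  by rewrite eq_sym -subr_eq0 opprK -[_ + _]/(2%:R) pnatr_eq0.
have [/existsP[i /andP[/eqP oi /eqP di]]|no2] :=
    boolP [exists i : sG, (irr_repr i z == (-1)%:M) && (irr_degree i == 2%N)].
  by move: (irr_repr i) oi; rewrite di => rS rSz; exists rS.
have := sum_odd_degree; rewrite cardG.
have simG := rsim_irr_comp_pchar sG F'G irrG.
have degG : 6%N = irr_degree (irr_comp sG rG) by case: simG.
rewrite (bigD1 (irr_comp sG rG)) /=; last by apply/eqP; exact: odd_rsim simG rGz.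
rewrite -degG -[(6 ^ 2)%N]/36%N; set s := (\sum_(_ | _) _)%N => sE.
have {sE}sE : s = 24%N.
  by apply/eqP; rewrite -(eqn_add2l 36) -(eqn_pmul2l (isT : (0 < 2)%N)) mul2n sE.
suff : (16 %| s)%N by rewrite sE.
apply: dvdn_sum => i /andP[oi ni].
have le24 : (irr_degree i ^ 2 <= 24)%N.
  by rewrite -sE /s (bigD1 i) /= ?oi ?ni // leq_addr.
have d2 : irr_degree i != 2%N.
  by apply: contraNN no2 => di; apply/existsP; exists i; rewrite oi.
have d0 := irr_degree_gt0 i; have := evn i (eqP oi).
move: le24 d2 d0; case: (irr_degree i) => [|[|[|[|[|d]]]]] //= le24.
by move: (leq_trans (leq_mul (isT : 5 <= d.+1.+4)%N (isT : 5 <= d.+1.+4)%N) le24).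
Qed.

End OddRepresentations.

(** * Irreducibility of the fifth symmetric power *)

Definition mx22 (R : Type) (a b c d : R) : 'M[R]_2 :=
  \matrix_(i, j) (if i == 0 then if j == 0 then a else b else if j == 0 then c else d).

Section SymmetricPowerIrreducible.

Variables (k : numClosedFieldType) (e : k).
Hypothesis e_prim : 5.-primitive_root e.

Variables x y : k.
Hypotheses (x0 : x != 0) (y0 : y != 0) (norm0 : x ^+ 2 + y ^+ 2 != 0).

Definition mxD := mx22 (e ^+ 4) 0 0 e.
Definition mxJ : 'M[k]_2 := mx22 0 1 (-1) 0.
Definition mxT := mx22 x y y (- x).

Let e5 : e ^+ 5 = 1. Proof. exact: prim_expr_order. Qed.

Let e_neq1 m : ~~ (5 %| m)%N -> e ^+ m != 1.
Proof. by rewrite (prim_order_dvd e_prim). Qed.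

Variable U : 'M[k]_6.
Hypothesis U_D : (U *m symmx 5 mxD <= U)%MS.
Hypothesis U_J : (U *m symmx 5 mxJ <= U)%MS.
Hypothesis U_T : (U *m symmx 5 mxT <= U)%MS.
Hypothesis U0 : U != 0.

Let mulU A (v : 'rV_6) : (U *m A <= U)%MS -> (v <= U)%MS -> (v *m A <= U)%MS.
Proof. by move=> UA vU; apply: submx_trans UA; exact: submxMr. Qed.

Let linfE (a b c d : k) : (linf (mx22 a b c d) 0 = a%:P + b *: 'X) *
  (linf (mx22 a b c d) 1 = c%:P + d *: 'X).
Proof. by rewrite /linf !mxE. Qed.

Let symD (i : 'I_6) j : symmx 5 mxD i j = (e ^+ (2 * i)) *+ (i == j).
Proof.
rewrite symmxE !linfE scale0r addr0 polyC0 add0r exprZn -polyC_exp mul_polyC.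
rewrite scalerA coefZ coefXn eq_sym -exprM -exprD mulr_natr; congr (_ *+ _).
apply/eqP; rewrite (eq_prim_root_expr e_prim).
by case: i => [[|[|[|[|[|[|]]]]]]].
Qed.

Let symJ (i j : 'I_6) : symmx 5 mxJ i j = (-1) ^+ i *+ (j == 5 - i :> nat)%N.
Proof.
rewrite symmxE !linfE scale0r addr0 polyC0 add0r scale1r -polyC_exp mulrC mul_polyC.
by rewrite coefZ coefXn mulr_natr.
Qed.

(** Averaging over the powers of D isolates the coordinates of equal weight. *)
Let weight_part (v : 'rV_6) (j : 'I_6) : (v <= U)%MS ->
  ((\row_i (v 0 i *+ (i == j %[mod 5])%N)) <= U)%MS.
Proof.
move=> vU.
have powU m : (v *m symmx 5 mxD ^+ m <= U)%MS.
  elim: m => [|m IH]; first by rewrite mulmx1.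
  by rewrite exprSr mulmxA; exact: mulU.
have powE m i : (v *m symmx 5 mxD ^+ m) 0 i = v 0 i * e ^+ (2 * i * m).
  elim: m i => [|m IH] i; first by rewrite mulmx1 muln0 mulr1.
  rewrite exprSr mulmxA mxE (bigD1 i) //= big1 => [|l li]; last first.
    by rewrite symD (negPf li) mulr0.
  by rewrite addr0 symD eqxx mulr1n IH -mulrA -exprD -mulnSr.
have -> : \row_i (v 0 i *+ (i == j %[mod 5])%N) =
    5%:R^-1 *: \sum_(m < 5) e ^+ (3 * j * m) *: (v *m symmx 5 mxD ^+ m).
  apply/rowP=> i; rewrite [LHS]mxE [RHS]mxE summxE.
  transitivity (5%:R^-1 * (v 0 i * \sum_(m < 5) (e ^+ (2 * i + 3 * j)) ^+ m)).
    have [ij|ij] := boolP (i == j %[mod 5])%N.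
      have /eqP-> : e ^+ (2 * i + 3 * j) == 1.
        rewrite -(prim_order_dvd e_prim) /dvdn -modnDm -modnMmr (eqP ij) modnMmr modnDm.
        by rewrite -mulnDl modnMr.
      under eq_bigr do rewrite expr1n.
      by rewrite sumr_const card_ord mulrCA mulVf ?mulr1 // pnatr_eq0.
    have z1 : e ^+ (2 * i + 3 * j) - 1 != 0.
      rewrite subr_eq0 e_neq1 //; apply: contra ij => d.
      by case: i d => [[|[|[|[|[|[|]]]]]]] //= _; case: j => [[|[|[|[|[|[|]]]]]]].
    have : (e ^+ (2 * i + 3 * j) - 1) * \sum_(m < 5) (e ^+ (2 * i + 3 * j)) ^+ m = 0.
      by rewrite -subrX1 -exprM mulnC exprM e5 expr1n subrr.
    by move/eqP; rewrite mulf_eq0 (negPf z1) /= => /eqP->; rewrite !mulr0.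
  congr (_ * _); rewrite mulr_sumr; apply: eq_bigr => m _.
  by rewrite mxE powE mulrCA -exprM -exprD -mulnDl addnC.
apply: scalemx_sub; apply: summx_sub => m _; exact: scalemx_sub.
Qed.

Let d (i : nat) : 'rV[k]_6 := delta_mx 0 (inord i).

Let sub_scale (a : k) (v w : 'rV[k]_6) : a != 0 -> v = a *: w -> (v <= U)%MS -> (w <= U)%MS.
Proof. by move=> a0 ->; rewrite eqmx_scale. Qed.

(* A coordinate that no other index shares its weight with splits off. *)
Let split_mid (v : 'rV_6) j : (0 < j < 5)%N -> (v <= U)%MS -> v 0 (inord j) != 0 ->
  (d j <= U)%MS.
Proof.
move=> /andP[j0 j5] vU vj; have j6 := ltnW j5.
apply: (sub_scale vj _ (weight_part (inord j) vU)); apply/rowP=> i; rewrite !mxE eqxx /=.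
rewrite inordK // -val_eqE /= inordK //.
case: (eqVneq (nat_of_ord i) j) => [ij|ij]; first by rewrite ij eqxx mulr1 -(inord_val i) ij.
rewrite mulr0; case: eqP => // E; case/negP: ij.
by move: E j0 j5 {vj}; case: i => [[|[|[|[|[|[|]]]]]]] //= _; case: j j6 => [|[|[|[|[|]]]]].
Qed.

Let split_ends (v : 'rV_6) : (v <= U)%MS ->
  ((v 0 (inord 0) *: d 0 + v 0 (inord 5) *: d 5)%R <= U)%MS.
Proof.
move=> vU; rewrite (_ : _ + _ = \row_i (v 0 i *+ (i == (inord 0 : 'I_6) %[mod 5])%N)).
  exact: weight_part.
apply/rowP=> i; rewrite !mxE eqxx /= -!val_eqE /= !inordK //.
have -> : v 0 i = v 0 (inord i) by rewrite inord_val.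
by case: i => [[|[|[|[|[|[|]]]]]]] //= _; rewrite ?(mulr0, mulr1, addr0, add0r).
Qed.

Let rowT i : 'rV[k]_6 := row (inord i) (symmx 5 mxT).

Let d_T i : (d i <= U)%MS -> (rowT i <= U)%MS.
Proof. by move=> dU; rewrite /rowT rowE; exact: mulU. Qed.

Let rowTE i j : (i < 6)%N -> (j < 6)%N ->
  rowT i 0 (inord j) = ((x%:P + y *: 'X) ^+ (5 - i) * (y%:P + (- x) *: 'X) ^+ i)`_j.
Proof. by move=> i6 j6; rewrite mxE symmxE !linfE !inordK. Qed.

Let row0E j : (j < 6)%N -> rowT 0 0 (inord j) = ('C(5, j))%:R * x ^+ (5 - j) * y ^+ j.
Proof.
move=> j6; rewrite rowTE // mulr1.
have -> : (x%:P + y *: 'X) ^+ 5 = (x ^+ 5)%:P + (5 * x ^+ 4 * y) *: 'X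
   + (10 * x ^+ 3 * y ^+ 2) *: 'X^2 + (10 * x ^+ 2 * y ^+ 3) *: 'X^3
   + (5 * x * y ^+ 4) *: 'X^4 + (y ^+ 5) *: 'X^5.
  by rewrite -!mul_polyC !(polyCM, polyC_exp, polyC_natr); ring.
rewrite !coefD !coefZ coefC !coefXn coefX.
have b : ('C(5, 2) = 10) /\ ('C(5, 3) = 10) /\ ('C(5, 1) = 5) /\ ('C(5, 4) = 5) by [].
case: b => b2 [b3 [b1 b4]].
by case: j j6 => [|[|[|[|[|[|]]]]]] //= _; rewrite ?(b1, b2, b3, b4, bin0, binn); ring.
Qed.

Let row5E j : (j < 6)%N -> rowT 5 0 (inord j) = ('C(5, j))%:R * y ^+ (5 - j) * (- x) ^+ j.
Proof.
move=> j6; rewrite rowTE // subnn expr0 mul1r.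
have -> : (y%:P + (- x) *: 'X) ^+ 5 = (y ^+ 5)%:P - (5 * y ^+ 4 * x) *: 'X
   + (10 * y ^+ 3 * x ^+ 2) *: 'X^2 - (10 * y ^+ 2 * x ^+ 3) *: 'X^3
   + (5 * y * x ^+ 4) *: 'X^4 - (x ^+ 5) *: 'X^5.
  by rewrite -!mul_polyC !(polyCM, polyC_exp, polyC_natr, polyCN); ring.
rewrite !(coefD, coefN) !coefZ coefC !coefXn coefX.
have b : ('C(5, 2) = 10) /\ ('C(5, 3) = 10) /\ ('C(5, 1) = 5) /\ ('C(5, 4) = 5) by [].
case: b => b2 [b3 [b1 b4]].
by case: j j6 => [|[|[|[|[|[|]]]]]] //= _; rewrite ?(b1, b2, b3, b4, bin0, binn); ring.
Qed.

Let d_J i : (i < 6)%N -> d i *m symmx 5 mxJ = (-1) ^+ i *: d (5 - i).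
Proof.
move=> i6; rewrite /d -rowE; apply/rowP=> j; rewrite mxE symJ inordK // !mxE eqxx /=.
by rewrite -val_eqE /= inordK ?ltnS ?leq_subr // mulr_natr.
Qed.

Let d_subJ i : (i < 6)%N -> (d i <= U)%MS -> (d (5 - i) <= U)%MS.
Proof.
move=> i6 /(mulU U_J) dU; apply: (sub_scale _ (d_J i6) dU).
by rewrite signr_eq0.
Qed.

(** The two middle coordinates of the image under T would both vanish only if the
    matrix [x, y; y, -x] were singular. *)
Let two_ends_mid (a b : k) : ((a *: d 0 + b *: d 5)%R <= U)%MS ->
  (a != 0) || (b != 0) -> (d 2 <= U)%MS.
Proof.
move=> abU ab; have := mulU U_T abU; rewrite mulmxDl -!scalemxAl -!rowE.
rewrite -/(rowT 0) -/(rowT 5); set v := (_ + _)%R => vU.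
have vE j : v 0 j = a * rowT 0 0 j + b * rowT 5 0 j.
  by rewrite /v; move: (rowT 0) (rowT 5) => p q; rewrite !mxE.
have v2 : v 0 (inord 2) = 10 * x ^+ 2 * y ^+ 2 * (a * x + b * y).
  have b2 : 'C(5, 2) = 10 by [].
  by rewrite vE row0E // row5E // b2 /=; ring.
have v3 : v 0 (inord 3) = 10 * x ^+ 2 * y ^+ 2 * (a * y - b * x).
  have b3 : 'C(5, 3) = 10 by [].
  by rewrite vE row0E // row5E // b3 /=; ring.
have c0 : 10 * x ^+ 2 * y ^+ 2 != 0.
  by rewrite !mulf_neq0 ?expf_neq0 // pnatr_eq0.
have [v20|] := eqVneq (a * x + b * y) 0; last first.
  by move=> n0; apply: (split_mid (v := v)) => //; rewrite v2 mulf_neq0.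
have [v30|n0] := eqVneq (a * y - b * x) 0; last first.
  apply: (d_subJ (i := 3)) => //; apply: (split_mid (v := v)) => //.
  by rewrite v3 mulf_neq0.
apply: contraLR ab => _; rewrite negb_or !negbK; apply/andP; split.
  rewrite -(mulIr_eq0 _ (mulIf norm0)).
  have -> : a * (x ^+ 2 + y ^+ 2) = (a * x + b * y) * x + (a * y - b * x) * y by ring.
  by rewrite v20 v30 !mul0r addr0.
rewrite -(mulIr_eq0 _ (mulIf norm0)).
have -> : b * (x ^+ 2 + y ^+ 2) = (a * x + b * y) * y - (a * y - b * x) * x by ring.
by rewrite v20 v30 !mul0r subr0.
Qed.

(** The end part of the image under T is proportional to (x, y), and its image under J
    to (-y, x). *)
Let mid_d0 : (d 2 <= U)%MS -> (d 0 <= U)%MS.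
Proof.
move=> /d_T/split_ends; rewrite !rowTE //.
have -> : (x%:P + y *: 'X) ^+ (5 - 2) * (y%:P + - x *: 'X) ^+ 2 =
  (x ^+ 3 * y ^+ 2)%:P + (3 * x ^+ 2 * y ^+ 3 - 2 * x ^+ 4 * y) *: 'X
  + (x ^+ 5 - 6 * x ^+ 3 * y ^+ 2 + 3 * x * y ^+ 4) *: 'X^2
  + (3 * x ^+ 4 * y - 6 * x ^+ 2 * y ^+ 3 + y ^+ 5) *: 'X^3
  + (3 * x ^+ 3 * y ^+ 2 - 2 * x * y ^+ 4) *: 'X^4 + (x ^+ 2 * y ^+ 3) *: 'X^5.
  rewrite subnE /= -!mul_polyC.
  by rewrite !(polyCM, polyC_exp, polyC_natr, polyCN, polyCD, polyCB); ring.
rewrite !coefD !coefZ !coefC !coefXn !coefX /= !(mulr0, mulr1, addr0, add0r).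
set w := (_ + _)%R => wU; have wJ := mulU U_J wU.
have wE : w = (x ^+ 2 * y ^+ 2) *: (x *: d 0 + y *: d 5).
  by rewrite scalerDr !scalerA; congr (_ *: _ + _ *: _); ring.
have wJE : w *m symmx 5 mxJ = (x ^+ 2 * y ^+ 2) *: (x *: d 5 - y *: d 0).
  rewrite wE -scalemxAl mulmxDl -!scalemxAl !d_J // expr0 scale1r.
  by rewrite (_ : (-1) ^+ 5 = -1) ?scaleN1r ?scalerN //; ring.
apply: (@sub_scale (x ^+ 2 * y ^+ 2 * (x ^+ 2 + y ^+ 2)) (x *: w - y *: (w *m symmx 5 mxJ))).
- by rewrite !mulf_neq0 ?expf_neq0.
- rewrite wJE wE; apply/rowP=> i; rewrite !mxE; move: (_%:R) (_%:R) => p q; ring.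
by rewrite addmx_sub ?scalemx_sub // eqmx_opp scalemx_sub.
Qed.

Let d0_full : (d 0 <= U)%MS -> row_full U.
Proof.
move=> d0U; rewrite -sub1mx; apply/row_subP=> i; rewrite rowE mulmx1 -(inord_val i).
case: (posnP i) => [->//|i0]; case: (ltnP i 5) => [i5|i5]; last first.
  have -> : nat_of_ord i = 5%N by apply/eqP; rewrite eqn_leq i5 -ltnS ltn_ord.
  exact: (d_subJ (i := 0)).
apply: (split_mid (v := rowT 0)); rewrite ?i0 ?i5 ?d_T // row0E //.
by rewrite !mulf_neq0 ?expf_neq0 // pnatr_eq0 -lt0n bin_gt0 ltnW.
Qed.

(** Under D the end monomials share a weight, and the other weights are simple. A
    stable subspace thus contains an inner monomial, or a combination of the ends;
    T maps inner monomials to vectors with an end part, and combinations of the ends to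
    vectors with a part in the middle. The middle monomials lead to an end monomial,
    and T maps that one to a vector with all coordinates non-zero. *)
Lemma sym5_stable_full : row_full U.
Proof.
apply/d0_full/mid_d0.
have [v vU [j vj]] : exists2 v : 'rV_6, (v <= U)%MS & exists j, v 0 j != 0.
  have /rowV0Pn[v vU v0] := U0; exists v => //; apply/existsP; apply: contraNT v0.
  by rewrite negb_exists => /forallP v0; apply/eqP/rowP=> j; rewrite mxE; apply/eqP/negbNE.
move: vj; rewrite -(inord_val j) => vj.
have endsU (w : 'rV_6) : (w <= U)%MS -> (w 0 (inord 0) != 0) || (w 0 (inord 5) != 0) -> (d 2 <= U)%MS.
  by move=> /split_ends; exact: two_ends_mid.
case: (posnP j) => [j0|j0]; first by apply: (endsU v) => //; move: vj; rewrite j0 => ->.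
case: (ltnP j 5) => [j5|j5]; last first.
  have j5E : nat_of_ord j = 5%N by apply/eqP; rewrite eqn_leq j5 -ltnS ltn_ord.
  by apply: (endsU v) => //; move: vj; rewrite j5E => ->; rewrite orbT.
have dU : (d j <= U)%MS by apply: (split_mid (v := v)); rewrite ?j0.
apply: (endsU (rowT j)); first exact: d_T.
rewrite rowTE //.
rewrite -horner_coef0 hornerM !horner_exp !hornerE.
by rewrite mulf_neq0 ?expf_neq0.
Qed.

End SymmetricPowerIrreducible.

(** * The binary icosahedral group *)

Section EvenPermutations.

Local Open Scope group_scope.

Let o (i : nat) (i5 : (i < 5)%N) : 'I_5 := Ordinal i5.
Notation "# i" := (o (isT : (i < 5)%N)) (at level 0).

(** Modulo 5, flip_a is i -> -i and flip_b is i -> 1 - i; their product is a five-cycle,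
    inverted by both of them, and flip_c is another involution commuting with flip_a. *)
Definition flip_a : {perm 'I_5} := tperm #1 #4 * tperm #2 #3.
Definition flip_b : {perm 'I_5} := tperm #0 #1 * tperm #2 #4.
Definition flip_c : {perm 'I_5} := tperm #1 #3 * tperm #2 #4.

Let flipE := (permM, permE).

Lemma flip_even : [/\ flip_a \in 'Alt_('I_5), flip_b \in 'Alt_('I_5) & flip_c \in 'Alt_('I_5)].
Proof. by split; rewrite Alt_even odd_permM !odd_tperm. Qed.

Lemma flip_involutions :
  [/\ flip_a ^+ 2 = 1, flip_b ^+ 2 = 1, flip_c ^+ 2 = 1 & (flip_c * flip_a) ^+ 2 = 1].
Proof.
by split; apply/permP=> -[[|[|[|[|[|]]]]] //= ?]; rewrite !flipE /=; exact: val_inj.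
Qed.

Lemma flip_nontrivial : [/\ flip_a != 1, flip_c != 1 & flip_c * flip_a != 1].
Proof.
by split; apply/eqP=> /permP/(_ #1)/(congr1 val); rewrite perm1 !flipE.
Qed.

Lemma five_cycle : (flip_a * flip_b) ^+ 5 = 1 /\ flip_a * flip_b != 1.
Proof.
split; last by apply/eqP=> /permP/(_ #1)/(congr1 val); rewrite perm1 !flipE.
have cE i : (flip_a * flip_b) i = (i.+1 %% 5)%N :> nat.
  by case: i => [[|[|[|[|[|]]]]] //= ?]; rewrite !flipE.
have cnE n i : iter n (flip_a * flip_b) i = ((i + n) %% 5)%N :> nat.
  elim: n => [|n IH]; first by rewrite addn0 modn_small.
  by rewrite iterS cE IH -addn1 modnDml addn1 addnS.
by apply/permP=> i; apply: ord_inj; rewrite permX cnE modnDr perm1 modn_small.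
Qed.

(** The second inequality says that flip_c does not invert the five-cycle. *)
Lemma flip_c_five_cycle : flip_a * flip_b * flip_c != flip_c * (flip_a * flip_b) /\
  flip_a * flip_b * flip_c != flip_c * (flip_b * flip_a).
Proof.
by split; apply/eqP=> /permP/(_ #0)/(congr1 val); rewrite !flipE.
Qed.

End EvenPermutations.

Section BinaryIcosahedral.

Local Open Scope group_scope.

Variables (gT : finGroupType) (G Z : {group gT}).
Hypotheses (sZ : Z \subset 'Z(G)) (cardZ : #|Z| = 2%N) (nsplit : ~~ splits_over G Z).
Hypothesis isoA : (G / Z) \isog 'Alt_('I_5).

Let sZG : Z \subset G. Proof. exact: subset_trans sZ (center_sub G). Qed.

Let nZG : G \subset 'N(Z).
Proof. by apply: cents_norm; rewrite centsC (subset_trans sZ) ?subsetIr. Qed.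

Let nsZG : Z <| G. Proof. exact/andP. Qed.

Let simpleGZ : simple (G / Z).
Proof. by rewrite (isog_simple isoA) simple_Alt5 ?card_ord. Qed.

Lemma card_icosahedral : #|G| = 120%N.
Proof.
have := card_Alt (T := 'I_5); rewrite card_ord => /(_ isT) cA.
rewrite -(Lagrange sZG) cardZ -card_quotient // (card_isog isoA).
by rewrite cA.
Qed.

(** The non-splitting of the extension means that Z lies in the Frattini subgroup. *)
Lemma nonsplit_supplement (N : {group gT}) : G \subset Z * N -> N \subset G -> N :=: G.
Proof.
move=> sGZN sNG; have eG : Z * N = G.
  by apply/eqP; rewrite eqEsubset mul_subG.
have [tiNZ|ntNZ] := eqVneq (N :&: Z) 1.
  by case/negP: nsplit; apply/splitsP; exists N; apply/complP; split; first rewrite setIC.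
have sZN : Z \subset N by rewrite (prime_meetG _ (_ : Z :&: N != 1)) ?cardZ // setIC.
by apply/eqP; rewrite eqEsubset sNG (subset_trans sGZN) // mul_subG.
Qed.

Lemma icosahedral_normal (N : {group gT}) : N <| G -> N \subset Z \/ N :=: G.
Proof.
move=> nN; have /simpleP[_ /(_ (N / Z)%G)] := simpleGZ.
rewrite quotient_normal // => /(_ isT) [N1|NG]; [left | right].
  by rewrite -quotient_sub1 ?(subset_trans (normal_sub nN)) // -N1.
apply: nonsplit_supplement (normal_sub nN).
by rewrite -quotientSK // -NG.
Qed.

Lemma icosahedral_perfect : G^`(1) = G.
Proof.
have [sG'Z|//] := icosahedral_normal (der_normal 1 G).
have : solvable 'Alt_('I_5).
  by rewrite -(isog_sol isoA) abelian_sol // sub_der1_abelian.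
by rewrite solvable_AltF ?card_ord.
Qed.

(** Lifts of a five-cycle, of an involution inverting it, and of an involution that
    commutes with the first one without normalizing the cycle. *)
Lemma icosahedral_triple : exists c h t : gT,
  [/\ c \in G, h \in G & t \in G] /\
  [/\ c ^+ 5 = 1, c != 1, c * h = h * c^-1, c * t != t * c & c * t != t * c^-1] /\
  [/\ h ^+ 2 \in Z, t ^+ 2 \in Z & (t * h) ^+ 2 \in Z] /\
  [/\ h \notin Z, t \notin Z & t * h \notin Z].
Proof.
case/isogP: isoA => f injf imf; pose pi x := f (coset Z x).
have inGZ x : x \in G -> coset Z x \in G / Z by exact: mem_quotient.
have piM : {in G &, {morph pi : x y / x * y}}.
  move=> x y xG yG; rewrite /pi morphM ?(subsetP nZG) // morphM ?inGZ //.
have piV : {in G, forall x, pi x^-1 = (pi x)^-1}.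
  move=> x xG; rewrite /pi morphV ?(subsetP nZG) // morphV ?inGZ //.
have piX n : {in G, forall x, pi (x ^+ n) = pi x ^+ n}.
  move=> x xG; rewrite /pi morphX ?(subsetP nZG) // morphX ?inGZ //.
have piJ x y : x \in G -> y \in G -> pi (x ^ y) = pi x ^ pi y.
  by move=> xG yG; rewrite /conjg (piM _ _ (groupVr yG) (groupM xG yG)) piM // piV.
have piZ x : x \in G -> (x \in Z) = (pi x == 1).
  move=> xG; rewrite /pi morph_injm_eq1 ?inGZ //.
  by apply/idP/eqP=> [xZ|/coset_idr]; [exact: coset_id | apply; exact: (subsetP nZG)].
have lift a : a \in 'Alt_('I_5) -> exists2 x, x \in G & pi x = a.
  by rewrite -imf => /morphimP[y _ /morphimP[x _ xG ->] ->]; exists x.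
have Z2 x : x \in Z -> x ^+ 2 = 1.
  by move=> xZ; rewrite -cardZ expg_cardG.
have [Aa Ab Ac] := flip_even; have [a2 b2 t2 ta2] := flip_involutions.
have [a1 t1 ta1] := flip_nontrivial; have [c5 c1] := five_cycle.
have [ct ct'] := flip_c_five_cycle.
have [c0 c0G pc0] := lift _ (groupM Aa Ab).
have [h hG ph] := lift _ Aa; have [t tG pt] := lift _ Ac.
pose c := c0 ^+ 6; have cG : c \in G by rewrite groupX.
have pc : pi c = flip_a * flip_b by rewrite piX // pc0 expgS c5 mulg1.
have c5' : c ^+ 5 = 1.
  rewrite -expgM -[(6 * 5)%N]/(5 * 2 * 3)%N 2!expgM Z2 ?expg1n //.
  by rewrite piZ ?groupX // piX // pc0 c5.
have inv2 (x : {perm 'I_5}) : x ^+ 2 = 1 -> x^-1 = x.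
  by move/eqP; rewrite expg2 -eq_invg_mul => /eqP.
have abw (x y : {perm 'I_5}) : x ^+ 2 = 1 -> y ^+ 2 = 1 -> x * y * (x * (x * y * x)) = 1.
  move=> /inv2 x2 /inv2 y2; have <- : x * y * (x^-1 * (x * (y^-1 * x^-1))) = 1.
    by rewrite mulKg -invMg mulgV.
  by rewrite x2 y2 !mulgA.
have baV : flip_b * flip_a = (flip_a * flip_b)^-1.
  by rewrite invMg !inv2.
clearbody c; exists c, h, t; split; first by split.
split; last split.
- split=> //.
  + by apply: contraNneq c1 => c1'; rewrite -pc c1' -[1](expg0 1) piX // expg0.
  + pose w := c * c ^ h.
    have wZ : w \in Z.
      rewrite piZ; last by rewrite groupM ?groupJ.
      rewrite /w (piM _ _ cG (groupJ cG hG)) piJ // pc ph /conjg inv2 //.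
      by rewrite abw.
    have wE : c ^ h = c^-1 * w by rewrite mulKg.
    have cw : commute c^-1 w.
      by case/setIP: (subsetP sZ w wZ) => _ /centP wC; apply/commute_sym/wC; rewrite groupV.
    have : (c ^ h) ^+ 5 = 1 by rewrite -conjXg c5' conj1g.
    rewrite wE expgMn // expgVn c5' invg1 mul1g -[5%N]/(2 * 2 + 1)%N expgD expgM (Z2 w wZ).
    rewrite expg1n mul1g expg1 => w1.
    by move: wE; rewrite w1 mulg1 => <-; rewrite -conjgC.
  + by apply: contraNneq ct => /(congr1 pi); rewrite (piM _ _ cG tG) (piM _ _ tG cG) pc pt => ->.
  by apply: contraNneq ct' => /(congr1 pi); rewrite (piM _ _ cG tG) piM ?groupV // piV // pc pt -baV => ->.
- by split; rewrite piZ ?groupX ?groupM // piX ?groupM // ?piM // ?ph ?pt ?a2 ?t2 ?ta2.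
by split; rewrite piZ ?groupM // ?piM // ?ph ?pt.
Qed.

End BinaryIcosahedral.

(** * Two-dimensional representations *)

Section TwoByTwo.

Variable k : numClosedFieldType.
Implicit Types A B : 'M[k]_2.

Lemma mx22E A : A = mx22 (A 0 0) (A 0 1) (A 1 0) (A 1 1).
Proof.
by apply/matrixP=> i j; rewrite mxE; case/orP: (ord2P i) => /eqP->; case/orP: (ord2P j) => /eqP->.
Qed.

Lemma trace22 A : \tr A = A 0 0 + A 1 1.
Proof. by rewrite /mxtrace big_ord_recl big_ord1 /=; congr (_ + A _ _); exact: val_inj. Qed.

Lemma Cayley_Hamilton22 A : A *m A = \tr A *: A - (\det A)%:M.
Proof.
rewrite (mx22E A) det2 trace22; apply/matrixP=> i j; rewrite !mxE big_ord_recl big_ord1.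
case/orP: (ord2P i) => /eqP->; case/orP: (ord2P j) => /eqP->; rewrite !mxE /=; ring.
Qed.

Lemma mul_mx22 (a b c d a' b' c' d' : k) : mx22 a b c d *m mx22 a' b' c' d' =
  mx22 (a * a' + b * c') (a * b' + b * d') (c * a' + d * c') (c * b' + d * d').
Proof.
apply/matrixP=> i j; rewrite !mxE big_ord_recl big_ord1 !mxE /=.
by do 2 case: ifP.
Qed.

(** An involution of the projective group lifts to a matrix of trace zero. *)
Lemma involution_trace0 A : \det A = 1 -> A * A = 1 \/ A * A = - 1 ->
  A != 1 -> A != - 1 -> A * A = - 1 /\ \tr A = 0.
Proof.
move=> dA A2 A1 AN1; have : A * A = \tr A *: A - 1.
  by have := Cayley_Hamilton22 A; rewrite dA.
case: A2 => A2; rewrite A2 => trA; last first.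
  split=> //; apply/eqP; move: trA => /esym/(canRL (subrK 1))/eqP; rewrite addNr.
  rewrite scaler_eq0 => /orP[//|/eqP A0]; move: dA; rewrite A0 det0 => /eqP.
  by rewrite eq_sym oner_eq0.
have tA : \tr A *: A = 2%:M.
  by rewrite -[2%:M]/(2%:R%:M) raddfMn /=; move/esym/(canRL (subrK 1)): trA.
have t0 : \tr A != 0.
  apply/eqP => t0; move: tA; rewrite t0 scale0r => /matrixP/(_ 0 0)/eqP.
  by rewrite !mxE eqxx eq_sym pnatr_eq0.
have AE : A = ((\tr A)^-1 * 2)%:M.
  by rewrite -scale_scalar_mx -tA scalerA mulVf ?scale1r.
have := dA; rewrite AE det_scalar => /eqP; rewrite sqrf_eq1 => /orP[/eqP a1|/eqP a1].
  by case/eqP: A1; rewrite AE a1.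
by case/eqP: AN1; rewrite AE a1 raddfN.
Qed.

Section Frame.

Variables C H T : 'M[k]_2.
Hypotheses (C5 : C ^+ 5 = 1) (C1 : C != 1) (dC : \det C = 1) (dT : \det T = 1).
Hypotheses (CHC : C * H * C = H) (H2 : H * H = - 1).
Hypotheses (trT : \tr T = 0) (trTH : \tr (T * H) = 0).
Hypotheses (CT : C * T != T * C) (CTC : C * T * C != T).

Lemma order5_eigenvector : exists a (v : 'rV_2), [/\ v != 0, v *m C = a *: v & 5.-primitive_root a].
Proof.
have [a aC] : exists a, eigenvalue C a.
  have /closed_rootP[a] : size (char_poly C) != 1 by rewrite size_char_poly.
  by rewrite -eigenvalue_root_char; exists a.
have /eigenvalueP[v vC v0] := aC; exists a, v; split=> //.
have vn n : v *m C ^+ n = a ^+ n *: v.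
  elim: n => [|n IH]; first by rewrite mulmx1 scale1r.
  by rewrite exprSr mulmxA IH -scalemxAl vC scalerA exprSr.
have a5 : a ^+ 5 = 1.
  have := vn 5; rewrite C5 mulmx1 => /eqP; rewrite -{1}[v]scale1r -subr_eq0 -scalerBl.
  by rewrite scaler_eq0 (negPf v0) orbF subr_eq0 => /eqP.
have [m m_prim m5] := prim_order_exists (isT : (0 < 5)%N) a5.
case/primeP: (isT : prime 5) => _ /(_ m m5) /orP[/eqP m1|/eqP <- //].
have a1 : a = 1 by move/prim_expr_order: m_prim; rewrite m1.
(* Otherwise C is unipotent, hence of infinite order. *)
pose N := C - 1; have CE : C = 1 + N by rewrite addrC subrK.
have /eqP dN : \det N == 0.
  by apply/det0P; exists v => //; rewrite mulmxBr vC a1 scale1r mulmx1 subrr.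
have trN : \tr N = 0.
  have : \det C = 1 + \tr N + \det N.
    by rewrite !det2 trace22 /N !mxE /=; ring.
  by rewrite dC dN addr0 => /esym/(canRL (addKr 1)); rewrite addNr.
have NN : N * N = 0.
  by have := Cayley_Hamilton22 N; rewrite trN dN scale0r raddf0 subr0.
have Cn n : C ^+ n = 1 + N *+ n.
  elim: n => [|n IH]; first by rewrite addr0.
  by rewrite exprS IH {1}CE mulrDl mul1r mulrDr mulr1 mulrnAr NN mul0rn addr0 -addrA -mulrSr.
move/eqP: C5; rewrite Cn -subr_eq0 addrC addKr -scaler_nat scaler_eq0 pnatr_eq0 /=.
by rewrite subr_eq0 (negPf C1).
Qed.

Let rows (v w : 'rV[k]_2) : 'M[k]_2 := \matrix_i (if i == 0 then v else w).

Let rows_mul v w A : rows v w *m A = rows (v *m A) (w *m A).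
Proof. by apply/row_matrixP=> i; rewrite row_mul !rowK; case: ifP. Qed.

Let mul_rows a b c d v w :
  mx22 a b c d *m rows v w = rows (a *: v + b *: w) (c *: v + d *: w).
Proof.
apply/row_matrixP=> i; rewrite row_mul rowK mulmx_sum_row big_ord_recl big_ord1 !rowK.
by rewrite !mxE /=; case: ifP.
Qed.

(** For an eigenvector v of C, the vector v H is an eigenvector for the inverse
    eigenvalue, as H inverts C. In this basis, the trace conditions leave for T only the
    form [x, y; y, -x]; if x or y were zero, T would normalize the group of C. *)
Lemma icosahedral_frame : exists P e x y, [/\ P \in unitmx, 5.-primitive_root e &
   [/\ x != 0, y != 0 & x ^+ 2 + y ^+ 2 != 0]] /\
  [/\ P *m C = mxD e *m P, P *m H = mxJ k *m P & P *m T = mxT x y *m P].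
Proof.
have [a [v [v0 vC a_prim]]] := order5_eigenvector.
have a5 := prim_expr_order a_prim.
pose w := v *m H; pose e := a ^+ 4; pose P := rows v w.
have wC : w *m C = e *: w.
  rewrite -{2}[w]mulmx1 /w -{2}CHC -!mulmxA.
  rewrite (mulmxA v C) vC -!scalemxAl !mulmxA.
  by rewrite mulmx1 scalerA /e -exprSr a5 scale1r.
have wH : w *m H = - v.
  by rewrite /w -mulmxA -[H *m H]/(H * H) H2 mulmxN mulmx1.
have e_prim : 5.-primitive_root e by rewrite prim_root_exp_coprime.
have eK : e ^+ 4 = a by rewrite -exprM -[(4 * 4)%N]/(5 * 3 + 1)%N exprD exprM a5 expr1n mul1r.
have ae : a - e != 0.
  rewrite subr_eq0 -[a]expr1 (eq_prim_root_expr a_prim) //.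
clearbody e; have uP : P \in unitmx.
  rewrite unitmxE unitfE; apply/det0P=> -[u u0 uP0].
  have uPE (b c : k) : u *m rows (b *: v) (c *: w) = (u 0 0 * b) *: v + (u 0 1 * c) *: w.
    rewrite mulmx_sum_row big_ord_recl big_ord1 !rowK /= !scalerA.
    by rewrite (_ : lift 0 0 = 1) //; exact: val_inj.
  have E1 : u 0 0 *: v + u 0 1 *: w = 0.
    by have := uPE 1 1; rewrite !scale1r !mulr1 uP0.
  have E2 : (u 0 0 * a) *: v + (u 0 1 * e) *: w = 0.
    by rewrite -uPE -vC -wC -rows_mul mulmxA uP0 mul0mx.
  have u00 : u 0 0 = 0.
    have : (u 0 0 * (a - e)) *: v = 0.
      have E3 : (u 0 0 * e) *: v + (u 0 1 * e) *: w = 0.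
        by rewrite (mulrC (u 0 0)) (mulrC (u 0 1)) -!scalerA -scalerDr E1 scaler0.
      by rewrite -[RHS](subrr 0) -{1}E2 -E3 opprD addrACA subrr addr0 mulrBr scalerBl.
    move/eqP; rewrite scaler_eq0 (negPf v0) orbF mulf_eq0 (negPf ae) orbF => /eqP//.
  have w0 : w != 0.
    apply: contraNneq v0 => w0; by rewrite -oppr_eq0 -wH w0 mul0mx.
  have u01 : u 0 1 = 0.
    by move/eqP: E1; rewrite u00 scale0r add0r scaler_eq0 (negPf w0) orbF => /eqP.
  case/eqP: u0; apply/rowP=> j; rewrite mxE.
  by case/orP: (ord2P j) => /eqP->.
have PC : P *m C = mxD e *m P.
  by rewrite rows_mul mul_rows vC wC eK !scale0r addr0 add0r.
have PH : P *m H = mxJ k *m P.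
  by rewrite rows_mul mul_rows wH !scale0r scaleN1r addr0 add0r scale1r.
pose T' := P *m T *m invmx P.
have PT : P *m T = T' *m P by rewrite mulmxKV.
have tr' : \tr T' = 0 by rewrite mxtrace_mulC mulmxA mulVmx // mul1mx.
have trJ : \tr (T' *m mxJ k) = 0.
  have -> : mxJ k = P *m H *m invmx P by rewrite PH mulmxK.
  by rewrite !mulmxA mulmxKV // mxtrace_mulC !mulmxA mulVmx // mul1mx.
have dT' : \det T' = 1.
  by rewrite /T' !det_mulmx dT mulr1 -det_mulmx mulmxV // det1.
have [x [y T'E]] : exists x y, T' = mxT x y.
  exists (T' 0 0), (T' 0 1); rewrite {1}(mx22E T'); move: tr' trJ.
  rewrite (mx22E T') mul_mx22 !trace22 !mxE /= => t1 t2; rewrite /mxT; congr mx22.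
    by move/eqP: t2; rewrite !mulr0 !mulr1 mulrN1 add0r addr0 addrC subr_eq0 => /eqP.
  by move/eqP: t1; rewrite addrC addr_eq0 => /eqP.
rewrite T'E in PT; have e5 := prim_expr_order e_prim.
exists P, e, x, y; split; last by split.
have xy : - (x ^+ 2 + y ^+ 2) = 1.
  by rewrite -dT' T'E det2 !mxE /=; ring.
split=> //; split.
- apply: contraNneq CTC => x0; apply/eqP/(can_inj (mulKmx uP)).
  rewrite -!mulmxE !mulmxA PC -(mulmxA _ P) PT !mulmxA -(mulmxA _ P) PC !mulmxA x0; congr (_ *m P).
  rewrite !mul_mx22 !(mul0r, mulr0, add0r, addr0) mulrAC -exprSr e5 mul1r.
  by rewrite oppr0 mulr0 !mul0r mulrAC -exprS e5 mul1r /mxT oppr0.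
- apply: contraNneq CT => y0; apply/eqP/(can_inj (mulKmx uP)).
  rewrite -!mulmxE !mulmxA PC -(mulmxA _ P) PT !mulmxA -(mulmxA _ P) PC !mulmxA y0; congr (_ *m P).
  by rewrite !mul_mx22 !(mul0r, mulr0, add0r, addr0) mulrC [e * _]mulrC.
by rewrite -oppr_eq0 xy oner_eq0.
Qed.

End Frame.

End TwoByTwo.

Section SymmetricPowerRepresentation.

Variables (k : numClosedFieldType) (gT : finGroupType) (G : {group gT}).
Variable rS : mx_representation k G 2.

Lemma sym_repr_proof n : mx_repr G (fun g => symmx n (rS g)).
Proof.
split=> [|g h gG hG]; first by rewrite repr_mx1 symmx1.
by rewrite repr_mxM // symmxM.
Qed.

Definition sym_repr n := MxRepresentation (sym_repr_proof n).

(** A change of basis in the plane brings generators into the normal form for which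
    irreducibility was checked. *)
Lemma sym5_irreducible c h t : c \in G -> h \in G -> t \in G ->
  (exists P e x y, [/\ P \in unitmx, 5.-primitive_root e &
   [/\ x != 0, y != 0 & x ^+ 2 + y ^+ 2 != 0]] /\
  [/\ P *m rS c = mxD e *m P, P *m rS h = mxJ k *m P & P *m rS t = mxT x y *m P]) ->
  mx_irreducible (sym_repr 5).
Proof.
move=> cG hG tG [P [e [x [y [[uP e_prim [x0 y0 xy]] [PC PH PT]]]]]].
apply/mx_irrP; split=> // U modU U0.
have conj g A : g \in G -> P *m rS g = A *m P ->
    (U *m symmx 5 (invmx P) *m symmx 5 A <= U *m symmx 5 (invmx P))%MS.
  move=> gG PA; have -> : A = P *m rS g *m invmx P by rewrite PA mulmxK.
  rewrite !symmxM !mulmxA -[U *m _ *m symmx 5 P]mulmxA -symmxM mulVmx // symmx1 mulmx1.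
  by apply: submxMr; exact: (mxmoduleP modU).
have US : U *m symmx 5 (invmx P) *m symmx 5 P = U.
  by rewrite -mulmxA -symmxM mulVmx // symmx1 mulmx1.
have fullU : row_full (U *m symmx 5 (invmx P)).
  apply: (sym5_stable_full e_prim x0 y0 xy (conj _ _ cG PC) (conj _ _ hG PH) (conj _ _ tG PT)).
  by apply: contraNneq U0 => V0; rewrite -US V0 mul0mx.
by rewrite /row_full eqn_leq rank_leq_col -{1}(eqP fullU) mxrankM_maxl.
Qed.

End SymmetricPowerRepresentation.

(** * The rationality theorem *)

Section Assembly.

Variables (k : numClosedFieldType) (gT : finGroupType) (G Z : {group gT}).
Hypotheses (sZ : Z \subset 'Z(G)%g) (cardZ : #|Z| = 2%N) (nsplit : ~~ splits_over G Z).
Hypothesis isoA : ((G / Z)%g \isog 'Alt_('I_5)).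

Lemma icosahedral_center : exists2 z, #[z]%g = 2%N & Z :=: [set 1%g; z].
Proof.
have /trivgPn[z zZ z1] : Z :!=: 1%g by rewrite -cardG_gt1 cardZ.
have oz : #[z]%g = 2%N.
  have /primeP[_ /(_ #[z]%g)] : prime 2 by [].
  by rewrite -cardZ order_dvdG // order_eq1 (negPf z1) cardZ /= => /(_ isT)/eqP.
exists z => //; rewrite -cycle2g //; apply/eqP.
by rewrite eq_sym eqEcard cycle_subG zZ cardZ -orderE oz.
Qed.

Variable rS : mx_representation k G 2.
Variable z : gT.
Hypotheses (ZE : Z :=: [set 1%g; z]) (rSz : rS z = (-1)%:M).

Let zG : z \in G.
Proof. by have /(subsetP sZ)/setIP[] : z \in Z by rewrite ZE set22. Qed.

Let rSZ x : x \in Z -> rS x = 1 \/ rS x = -1.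
Proof.
rewrite ZE => /set2P[->|->]; [left; exact: repr_mx1 | right].
by rewrite rSz raddfN.
Qed.

(** The kernel is either central, hence trivial since z acts non-trivially, or all
    of G. *)
Let faithS : mx_faithful rS.
Proof.
have [kZ|kG] := icosahedral_normal sZ cardZ nsplit isoA (rker_normal rS); last first.
  move: zG; rewrite -{1}kG => /rkerP[_]; rewrite rSz => /matrixP/(_ 0 0)/eqP.
  by rewrite !mxE eqxx eq_sym -subr_eq0 opprK -[_ + _]/(2%:R) pnatr_eq0.
apply/subsetP=> x xk; rewrite inE; have := subsetP kZ x xk; rewrite ZE => /set2P[->//|xz].
move: xk; rewrite xz => /rkerP[_]; rewrite rSz => /matrixP/(_ 0 0)/eqP.
by rewrite !mxE eqxx eq_sym -subr_eq0 opprK -[_ + _]/(2%:R) pnatr_eq0.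
Qed.

Let injS : {in G &, injective rS}.
Proof. exact: mx_faithful_inj. Qed.

Let detS : {in G, forall x, \det (rS x) = 1}.
Proof. by move=> x; rewrite -{1}(icosahedral_perfect sZ cardZ nsplit isoA); exact: det_derived. Qed.

Let involS x : x \in G -> (x ^+ 2)%g \in Z -> x \notin Z ->
  rS x * rS x = -1 /\ \tr (rS x) = 0.
Proof.
move=> xG x2 xZ; apply: involution_trace0; first exact: detS.
- by rewrite -mulmxE -repr_mxM // -expg2; exact: rSZ.
- apply: contraNneq xZ => x1; rewrite (injS xG (group1 G)) ?group1 //.
  by rewrite x1 repr_mx1.
apply: contraNneq xZ => x1; rewrite (injS xG zG) ?ZE ?set22 //.
by rewrite x1 rSz raddfN.
Qed.

Lemma sym5_icosahedral_irreducible : mx_irreducible (sym_repr rS 5).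
Proof.
have [c [h [t [[cG hG tG] [[c5 c1 ch ct ct'] [[h2 t2 th2] [hZ tZ thZ]]]]]]] :=
  icosahedral_triple sZ cardZ isoA.
apply: (sym5_irreducible cG hG tG).
have [hh _] := involS hG h2 hZ; have [_ trt] := involS tG t2 tZ.
have [_ trth] := involS (groupM tG hG) th2 thZ.
apply: icosahedral_frame => //.
- have rX n : rS (c ^+ n)%g = rS c ^+ n.
    elim: n => [|n IH]; first by rewrite expg0 repr_mx1.
    by rewrite expgS repr_mxM ?groupX // IH exprS mulmxE.
  by rewrite -rX c5 repr_mx1.
- apply: contraNneq c1 => c1'; apply/eqP/(injS cG (group1 G)); by rewrite c1' repr_mx1.
- exact: detS.
- exact: detS.
- by rewrite -!mulmxE -!repr_mxM ?groupM // ch mulgKV.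
- by rewrite -mulmxE -repr_mxM.
- by rewrite -!mulmxE -!repr_mxM //; apply: contraNneq ct => /injS->; rewrite ?groupM.
rewrite -!mulmxE -!repr_mxM ?groupM //; apply: contraNneq ct' => /injS E.
by rewrite -{2}E ?groupM // mulgK.
Qed.

End Assembly.

(** The given representation is the fifth symmetric power of the one of degree 2: both
    are irreducible and odd of degree 6, while 120 < 4 * 6^2. *)
Theorem icosahedral_rational (k : numClosedFieldType) (gT : finGroupType) (G : {group gT})
    (hG : binary_icosahedral G) (rG : mx_representation k G 6)
    (rG_irr : mx_irreducible rG) (rG_faithful : mx_faithful rG) :
  proj_quotient_rational rG.
Proof.
case: hG => Z [sZ cardZ isoA nsplit].
have [z oz ZE] := icosahedral_center cardZ.
have zZ : z \in 'Z(G)%g by rewrite (subsetP sZ) // ZE set22.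
have rGz := central_involution_repr zZ oz rG_irr rG_faithful.
have perfG := icosahedral_perfect sZ cardZ nsplit isoA.
have cardG := card_icosahedral sZ cardZ isoA.
have [|rS rSz] := odd_irreducible_degree2 zZ oz rG_irr rGz cardG.
  by rewrite perfG; case/setIP: zZ.
have irrS := sym5_icosahedral_irreducible sZ cardZ nsplit isoA ZE rSz.
have sz : sym_repr rS 5 z = (-1)%:M.
  rewrite /= rSz -[(-1)%:M]scalemx1 symmxZ symmx1 scalemx1; congr _%:M.
  by rewrite -signr_odd expr1.
have [|Q _ freeQ homQ] := odd_irreducible_rsim zZ oz rGz sz _ rG_irr irrS.
  by rewrite cardG.
apply: (@sym5_rational k gT G (fun g => rS g) rG Q).
- by move=> g h gG hG; rewrite repr_mxM.
- exact: repr_mx1.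
- by move=> g; rewrite -{1}perfG; exact: det_derived.
- by rewrite -row_free_unit.
by move=> g gG; rewrite homQ.
Qed.

Theorem theorem7p1 (R : realType) (gT : finGroupType) (G : {group gT})
    (hG : binary_icosahedral G) (rG : mx_representation R[i] G 6)
    (rG_irr : mx_irreducible rG) (rG_faithful : mx_faithful rG) :
  proj_quotient_rational rG.
Proof. exact: icosahedral_rational. Qed.
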